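(* Let $L$ be a locally compact Hausdorff space. Given $\{f_1,\ldots,f_\ell\}\subset C_0(L)$ such that $\|f_j\|\leq 1$ for $j=1,\ldots,\ell$, and given $\{\mu_1,\ldots,\mu_n\}\subset C_0(L)^*$ with $\|\mu_j\|\leq 1$ for $j=1,\ldots,n$, for each $\varepsilon>0$ there exists a norm one projection $P\colon C_0(L)\longrightarrow C_0(L)$ satisfying: (1) $\|P^*(\mu_j)-\mu_j\|<\varepsilon$ for $j=1,\ldots,n$; (2) $\|P(f_j)-f_j\|<\varepsilon$ for $j=1,\ldots,\ell$; (3) $P(C_0(L))$ is isometrically isomorphic to $\ell_\infty^p$ for some $p\in\mathbb{N}$.
   Context: The scalar field is $\mathbb{K}=\mathbb{R}$ or $\mathbb{C}$. $C_0(L)$ is the Banach space of all $\mathbb{K}$-valued continuous functions on $L$ vanishing at infinity, with the supremum norm; $C_0(L)^*$ is its topological dual, and $P^*$ is the adjoint operator of $P$. $\ell_\infty^p$ is $\mathbb{K}^p$ with the maximum norm. *)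

(* Defs.v *)
From HB Require Import structures.
From mathcomp Require Import all_boot all_order all_algebra.
From mathcomp Require Import all_classical all_reals topology normedtype.
From mathcomp Require Import complex.

Set Implicit Arguments.
Unset Strict Implicit.
Unset Printing Implicit Defensive.

Import Order.TTheory GRing.Theory Num.Theory.
Import numFieldNormedType.Exports.

Local Open Scope classical_set_scope.
Local Open Scope ring_scope.

Variant scalar_kind := RealScalars | ComplexScalars.

(* As everywhere in MathComp, norms of a normedModType K take their values in
   K itself: over R[i] they are complex numbers with zero imaginary part, and
   x <= y in R[i] means that y - x is a nonnegative real. *)
Definition scalar_field (R : realType) (k : scalar_kind) : numFieldType :=
  match k with RealScalars => R | ComplexScalars => R[i] end.

(* For sets of nonnegative scalars, suprema in the order of R[i] are suprema
   of real numbers. *)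
Section supremum_scalar.
Variables (R : realType) (k : scalar_kind).
Local Notation K := (scalar_field R k).
Implicit Types (A : set K) (x y M : K).

Lemma scalar_supremums_neq0 A x M :
  A x -> (forall y, A y -> 0 <= y) -> ubound A M -> supremums A !=set0.
Proof.
case: k A x M => /= A x M Ax A0 AM.
  exists (sup A); split; first by apply: sup_upper_bound; split; [exists x|exists M].
  by move=> y Ay; apply: ge_sup => //; exists x.
have ImA z : A z -> complex.Im z = 0.
  by move=> /A0; rewrite lecE => /andP[/eqP].
have hB : has_sup [set complex.Re z | z in A].
  split; first by exists (complex.Re x), x.
  by exists (complex.Re M) => _ [z /AM + <-]; rewrite lecE => /andP[].
exists (sup [set complex.Re z | z in A])%:C%C; split.
  move=> y Ay; rewrite lecE /= (ImA _ Ay) eqxx /=.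
  by apply: sup_upper_bound => //; exists y.
move=> y Ay; rewrite lecE /=; apply/andP; split.
  by have := Ay _ Ax; rewrite lecE (ImA _ Ax) => /andP[].
apply: ge_sup; first by exists (complex.Re x), x.
by move=> _ [z /Ay + <-]; rewrite lecE => /andP[].
Qed.

Lemma scalar_le_supremum A x M :
  (forall y, A y -> 0 <= y) -> ubound A M -> A x -> x <= supremum 0 A.
Proof.
move=> A0 AM Ax; have [s sA] := scalar_supremums_neq0 Ax A0 AM.
rewrite /supremum; case: ifPn => [/eqP A_0|_]; first by rewrite A_0 in Ax.
by case: xgetP => [t _ [tA _]|/(_ s)//]; exact: tA.
Qed.

Lemma scalar_supremum_le A M :
  (forall y, A y -> 0 <= y) -> 0 <= M -> ubound A M -> supremum 0 A <= M.
Proof.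
move=> A0 M0 AM; rewrite /supremum; case: ifPn => // /set0P[x Ax].
have [s sA] := scalar_supremums_neq0 Ax A0 AM.
by case: xgetP => [t _ [_ tA]|/(_ s)//]; exact: tA.
Qed.

Lemma scalar_supremum_ge0 A :
  (forall y, A y -> 0 <= y) -> 0 <= supremum 0 A.
Proof.
move=> A0; rewrite /supremum; case: ifPn => // /set0P[x Ax].
by case: xgetP => [s _ [sA _]|//]; rewrite (le_trans (A0 _ Ax))// sA.
Qed.

End supremum_scalar.

Section C0.
Variables (K : numFieldType) (L : topologicalType).

Definition vanishes_at_infinity (f : L -> K^o) :=
  forall e : K, 0 < e ->
    exists2 C : set L, compact C & forall x, ~ C x -> `|f x| < e.

Definition C0_pred : {pred L -> K^o} :=
  mem [set f | continuous f /\ vanishes_at_infinity f].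

Record C0 := MkC0 { C0_fun :> L -> K^o ; C0_funP : C0_fun \in C0_pred }.

HB.instance Definition _ := [isSub for C0_fun].
HB.instance Definition _ := [Choice of C0 by <:].

Lemma C0_continuous (f : C0) : continuous f.
Proof. by case: f => f /=; rewrite inE => -[]. Qed.

Lemma C0_vanishes (f : C0) : vanishes_at_infinity f.
Proof. by case: f => f /=; rewrite inE => -[]. Qed.

Lemma C0_submod_closed : submod_closed C0_pred.
Proof.
split=> [|a f g]; rewrite !inE /=.
  split; first exact: cst_continuous.
  by move=> e e0; exists set0; [exact: compact0|move=> x _; rewrite normr0].
move=> [cf vf] [cg vg]; split.
  move=> x; apply: (@continuousD _ _ _ (a *: f) g); last exact: cg.
  by apply: (@cvgZl_tmp _ _ _ (nbhs x) _ a f (f x)); exact: cf.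
move=> e e0.
have a1 : 0 < `|a| + 1 by rewrite ltr_wpDl.
have [C cC fC] := vf (e / 2 / (`|a| + 1)) ltac:(by rewrite !divr_gt0).
have [D cD gD] := vg (e / 2) ltac:(by rewrite divr_gt0).
exists (C `|` D); first exact: compactU.
move=> x /not_orP[/fC fx /gD gx].
rewrite (le_lt_trans (ler_normD _ _))// (splitr e) ler_ltD//.
rewrite normrZ; have := ltW fx; rewrite ler_pdivlMr// => h.
by rewrite (le_trans _ h)// mulrC ler_wpM2l// lerDl.
Qed.

HB.instance Definition _ :=
  GRing.isSubmodClosed.Build _ _ C0_pred C0_submod_closed.
HB.instance Definition _ := [SubChoice_isSubLmodule of C0 by <:].

Lemma C0_bounded (f : C0) : exists M, forall x, `|f x| <= M.
Proof.
have [C /compact_near_coveringP cC fC] := C0_vanishes f ltr01.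
have : \forall M \near +oo_K, C `<=` [set x | `|f x| <= M].
  apply: cC => x Cx.
  have nf : \forall x' \near x, `|f x'| <= `|f x| + 1.
    have /cvgrPdist_le/(_ 1 ltr01) := @C0_continuous f x.
    apply: filterS => y xy; rewrite -[X in `|X| <= _](subrK (f x)) addrC.
    by rewrite (le_trans (ler_normD _ _))// lerD2l distrC.
  exists ([set y | `|f y| <= `|f x| + 1], [set M | `|f x| + 1 <= M]) => /=.
    by split => //; apply: nbhs_pinfty_ge; rewrite realD.
  by move=> [y M] /= [] /le_trans; apply.
move=> CM; near +oo_K => M; exists M => x.
have [Cx|/fC/ltW fx] := pselect (C x).
  by move: x Cx; near: M.
by apply: le_trans fx _; near: M; apply: nbhs_pinfty_ge; exact: real1.
Unshelve. all: by end_near. Qed.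

End C0.

Section C0_norm.
Variables (R : realType) (k : scalar_kind) (L : topologicalType).
Local Notation K := (scalar_field R k).
Implicit Types f g : C0 K L.

Definition C0_norm f : K := supremum 0 [set `|f x| | x in [set: L]].

Lemma le_C0_norm f x : `|f x| <= C0_norm f.
Proof.
have [M fM] := C0_bounded f.
apply: (@scalar_le_supremum _ _ _ _ M); last by exists x.
  by move=> _ [y _ <-].
by move=> _ [y _ <-].
Qed.

Lemma C0_norm_le f (M : K) :
  0 <= M -> (forall x, `|f x| <= M) -> C0_norm f <= M.
Proof.
move=> M0 fM; apply: scalar_supremum_le => //; first by move=> _ [y _ <-].
by move=> _ [y _ <-].
Qed.

Lemma C0_norm_ge0 f : 0 <= C0_norm f.
Proof. by apply: scalar_supremum_ge0 => _ [y _ <-]. Qed.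

Lemma C0_normD f g : C0_norm (f + g) <= C0_norm f + C0_norm g.
Proof.
apply: C0_norm_le => [|x]; first by rewrite addr_ge0// C0_norm_ge0.
by rewrite (le_trans (ler_normD _ _))// lerD// le_C0_norm.
Qed.

Lemma C0_normZ (a : K) f : C0_norm (a *: f) = `|a| * C0_norm f.
Proof.
have le b g : C0_norm (b *: g) <= `|b| * C0_norm g.
  apply: C0_norm_le => [|x]; first by rewrite mulr_ge0// C0_norm_ge0.
  by rewrite normrZ ler_wpM2l// le_C0_norm.
apply/eqP; rewrite eq_le le /=.
have [->|a0] := eqVneq a 0; first by rewrite normr0 mul0r C0_norm_ge0.
rewrite -ler_pdivlMl ?normr_gt0//.
by have := le a^-1 (a *: f); rewrite scalerA mulVf// scale1r normfV.
Qed.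

Lemma C0_norm_eq0 f : C0_norm f = 0 -> f = 0.
Proof.
move=> f0; apply/val_inj/funext => x; apply/eqP.
by rewrite -normr_le0 -f0 le_C0_norm.
Qed.

HB.instance Definition _ :=
  Lmodule_isNormed.Build K (C0 K L) C0_normD C0_normZ C0_norm_eq0.

Lemma C0_normE f : `|f| = supremum 0 [set `|f x| | x in [set: L]].
Proof. by []. Qed.

End C0_norm.

Section bounded_operators.
Variables (K : numFieldType) (V W : normedModType K).

Definition clin_pred : {pred V -> W} :=
  mem [set T | linear T /\ continuous T].

Record clin := MkClin { clin_fun :> V -> W ; clin_funP : clin_fun \in clin_pred }.

HB.instance Definition _ := [isSub for clin_fun].
HB.instance Definition _ := [Choice of clin by <:].

Lemma clin_linear (T : clin) : linear T.
Proof. by case: T => T /=; rewrite inE => -[]. Qed.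

HB.instance Definition _ (T : clin) :=
  GRing.isLinear.Build K V W _ (clin_fun T) (clin_linear T).

Lemma clin_continuous (T : clin) : continuous T.
Proof. by case: T => T /=; rewrite inE => -[]. Qed.

Lemma clin_submod_closed : submod_closed clin_pred.
Proof.
split=> [|a S T]; rewrite !inE /=.
  split; last exact: cst_continuous.
  by move=> b u v /=; rewrite scaler0 addr0.
move=> [lS cS] [lT cT]; split.
  move=> b u v; rewrite !fctE lS lT !scalerDr !scalerA (mulrC a b).
  by rewrite addrACA.
move=> x; apply: (@continuousD _ _ _ (a *: S) T); last exact: cT.
by apply: (@cvgZl_tmp _ _ _ (nbhs x) _ a S (S x)); exact: cS.
Qed.

HB.instance Definition _ :=
  GRing.isSubmodClosed.Build _ _ clin_pred clin_submod_closed.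
HB.instance Definition _ := [SubChoice_isSubLmodule of clin by <:].

Lemma clin_bounded (T : clin) :
  exists2 M, 0 <= M & forall v, `|T v| <= M * `|v|.
Proof.
have := continuous_linear_bounded 0 (@clin_continuous T 0).
move=> /linear_boundedP Tb; near +oo_K => M; exists M.
  by near: M; apply: nbhs_pinfty_ge; exact: real0.
by near: M.
Unshelve. all: by end_near. Qed.

End bounded_operators.

Section operator_norm.
Variables (R : realType) (k : scalar_kind).
Local Notation K := (scalar_field R k).
Variables V W : normedModType K.
Implicit Types S T : clin V W.

Definition op_norm T : K :=
  supremum 0 [set `|T v| | v in [set v : V | `|v| <= 1]].

Lemma op_norm_ge0 T : 0 <= op_norm T.
Proof. by apply: scalar_supremum_ge0 => _ [y _ <-]. Qed.

Lemma op_norm_le T (M : K) :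
  0 <= M -> (forall v, `|v| <= 1 -> `|T v| <= M) -> op_norm T <= M.
Proof.
move=> M0 TM; apply: scalar_supremum_le => //; first by move=> _ [y _ <-].
by move=> _ [y /TM + <-].
Qed.

Lemma le_op_norm1 T v : `|v| <= 1 -> `|T v| <= op_norm T.
Proof.
move=> v1; have [M M0 TM] := clin_bounded T.
apply: (@scalar_le_supremum _ _ _ _ M); last by exists v.
  by move=> _ [y _ <-].
by move=> _ [y y1 <-]; rewrite (le_trans (TM _))// ler_piMr.
Qed.

Lemma le_op_norm T v : `|T v| <= op_norm T * `|v|.
Proof.
have [->|v0] := eqVneq v 0; first by rewrite linear0 !normr0 mulr0.
have nv : 0 < `|v| by rewrite normr_gt0.
rewrite -ler_pdivrMr//; have := @le_op_norm1 T (`|v|^-1 *: v).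
by rewrite linearZ !normrZ normfV normr_id mulVf ?gt_eqF// [X in _ -> X <= _]mulrC; apply.
Qed.

Lemma op_normD S T : op_norm (S + T) <= op_norm S + op_norm T.
Proof.
apply: op_norm_le => [|v v1]; first by rewrite addr_ge0// op_norm_ge0.
by rewrite (le_trans (ler_normD _ _))// lerD// le_op_norm1.
Qed.

Lemma op_normZ (a : K) T : op_norm (a *: T) = `|a| * op_norm T.
Proof.
have le b S : op_norm (b *: S) <= `|b| * op_norm S.
  apply: op_norm_le => [|v v1]; first by rewrite mulr_ge0// op_norm_ge0.
  by rewrite normrZ ler_wpM2l// le_op_norm1.
apply/eqP; rewrite eq_le le /=.
have [->|a0] := eqVneq a 0; first by rewrite normr0 mul0r op_norm_ge0.
rewrite -ler_pdivlMl ?normr_gt0//.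
by have := le a^-1 (a *: T); rewrite scalerA mulVf// scale1r normfV.
Qed.

Lemma op_norm_eq0 T : op_norm T = 0 -> T = 0.
Proof.
move=> T0; apply/val_inj/funext => v; apply/eqP.
by rewrite -normr_le0 (le_trans (le_op_norm _ _))// T0 mul0r.
Qed.

HB.instance Definition _ :=
  Lmodule_isNormed.Build K (clin V W) op_normD op_normZ op_norm_eq0.

Lemma op_normE T :
  `|T| = supremum 0 [set `|T v| | v in [set v : V | `|v| <= 1]].
Proof. by []. Qed.

End operator_norm.

Notation dual_space V := (clin V (GRing.regular _)).

Section adjoint.
Variables (K : numFieldType) (V W : normedModType K).

Lemma adjoint_subproof (T : clin V W) (mu : dual_space W) :
  (mu \o T : V -> K^o) \in @clin_pred K V K^o.
Proof.
rewrite inE; split=> [a u v|x] /=; first by rewrite !linearP.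
by apply: continuous_comp; exact: clin_continuous.
Qed.

Definition adjoint (T : clin V W) (mu : dual_space W) : dual_space V :=
  MkClin (adjoint_subproof T mu).

End adjoint.

Definition is_projection (K : numFieldType) (V : normedModType K)
  (P : clin V V) := forall v, P (P v) = P v.

(* The library norm of 'rV[K]_p is the maximum norm, so 'rV[K]_p is
   \ell_\infty^p. *)
Definition isometric_to_linfty (K : numFieldType) (V : normedModType K)
    (X : set V) (p : nat) :=
  exists J : {linear 'rV[K]_p -> V},
    (forall w, `|J w| = `|w|) /\ range J = X.

(* Main.v *)
(* Everything is reduced to real functions and real functionals. The total
   variations of the (real and imaginary parts of the) mu_j add up to a positive
   functional v, and each mu_j is approximated in norm by g_j v with g_j in
   C_0(L), the g_j being near-minimizers of v (g^2) - 2 mu_j(g) (an approximate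
   Riesz representation in the seminorm of L^2(v), so that neither measures nor
   completeness enter).

   Let u : L -> R^C collect the f's and the g's. A grid of small cells in R^C is
   shifted so that v has little mass near the cell boundaries. In every cell met
   by u, except the one containing 0, choose a probability functional lam_i that
   lives on a box B_i inside the cell: either the normalized restriction of v, or,
   if v does not charge the cell, the evaluation at a point. As the boxes are
   disjoint there is a partition of unity (phi_i), pulled back from R^C, with
   phi_i = 1 on B_i and phi_i supported near B_i; the member of index 0 is dropped,
   which makes the others vanish at infinity. Then P h = sum_i lam_i(h) phi_i is
   a norm one projection. It nearly fixes the f's because u varies little near
   each B_i. It nearly fixes g_j v because g_j is nearly constant on each
   cell and lam_i is proportional to v there. *)
From HB Require Import structures.
Require Import Defs.
From mathcomp Require Import all_boot all_order all_algebra.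
From mathcomp Require Import all_classical all_reals topology normedtype.
From mathcomp Require Import interval_inference complex ring lra.
Import Order.TTheory GRing.Theory Num.Theory.
Import numFieldNormedType.Exports.

Set Implicit Arguments.
Unset Strict Implicit.
Unset Printing Implicit Defensive.

Local Open Scope classical_set_scope.
Local Open Scope ring_scope.

(** * Real functions vanishing at infinity *)

Section vanishing_functions.
Variables (R : realType) (L : topologicalType).
Implicit Types f g h : L -> R.

(** On a compact space the empty set belongs to [at_infinity], hence a [Filter] and not a
    [ProperFilter]; [C0r] then amounts to continuity. *)
Definition at_infinity : set_system L :=
  [set A | exists2 C, compact C & ~` C `<=` A].

#[global] Instance at_infinity_filter : Filter at_infinity.
Proof.
split; first by exists set0; [exact: compact0|].
- move=> A B [C cC CA] [D cD DB]; exists (C `|` D); first exact: compactU.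
  by rewrite setCU => x [/CA ? /DB].
- by move=> A B AB [C cC CA]; exists C => //; exact: subset_trans AB.
Qed.

Definition C0r f := continuous f /\ f @ at_infinity --> (0 : R).

Lemma C0rP f : C0r f <-> f \in @C0_pred R L.
Proof.
rewrite inE; split=> -[cf f0]; split=> //.
  by move=> e e0; have /cvgr0Pnorm_lt/(_ e e0) := f0.
apply/cvgr0Pnorm_lt => e e0; exact: (f0 _ e0).
Qed.

Lemma C0r_bounded f : C0r f -> exists2 M, 0 <= M & forall x, `|f x| <= M.
Proof.
move=> /C0rP f0; have [M fM] := C0_bounded (MkC0 f0).
by exists (Num.max M 0) => [|x]; rewrite le_max ?lexx ?orbT// fM.
Qed.

Lemma C0r_dominated f g :
  continuous f -> C0r g -> (forall x, `|f x| <= `|g x|) -> C0r f.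
Proof.
move=> cf [_ g0] fg; split=> //; apply/cvgr0Pnorm_lt => e e0.
have /cvgr0Pnorm_lt/(_ e e0) := g0.
by apply: filterS => x; exact: le_lt_trans.
Qed.

Lemma C0r0 : C0r (fun=> 0).
Proof. by split; [exact: cst_continuous|exact: cvg_cst]. Qed.

Lemma C0rD f g : C0r f -> C0r g -> C0r (fun x => f x + g x).
Proof.
move=> [cf f0] [cg g0]; split; first by move=> x; exact: cvgD (cf x) (cg x).
by rewrite -[X in _ --> X]addr0; exact: cvgD.
Qed.

Lemma C0rMb f g b : continuous f -> (forall x, `|f x| <= b) -> C0r g ->
  C0r (fun x => f x * g x).
Proof.
move=> cf fb [cg g0]; apply: (@C0r_dominated _ (fun x => `|b| * g x)).
- by move=> x; exact: cvgM (cf x) (cg x).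
- split; first by move=> x; apply: cvgM (cg x); exact: cvg_cst.
  by rewrite -[X in _ --> X](mulr0 `|b|); apply: cvgM g0; exact: cvg_cst.
- by move=> x; rewrite !normrM normr_id ler_wpM2r// (le_trans (fb x))// ler_norm.
Qed.

Lemma C0rM f g : C0r f -> C0r g -> C0r (fun x => f x * g x).
Proof.
move=> f0 g0; have [b _ fb] := C0r_bounded f0.
by apply: (@C0rMb _ _ b) => //; case: f0.
Qed.

Lemma C0rZ a f : C0r f -> C0r (fun x => a * f x).
Proof. by apply: (@C0rMb _ _ `|a|) => //; exact: cst_continuous. Qed.

Lemma C0rN f : C0r f -> C0r (fun x => - f x).
Proof.
by move=> /(C0rZ (-1)); congr C0r; apply/funext => x; rewrite mulN1r.
Qed.

Lemma C0rB f g : C0r f -> C0r g -> C0r (fun x => f x - g x).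
Proof. by move=> f0 /C0rN; exact: C0rD. Qed.

Lemma C0r_sum (I : Type) (r : seq I) (P : pred I) (F : I -> L -> R) :
  (forall i, P i -> C0r (F i)) -> C0r (fun x => \sum_(i <- r | P i) F i x).
Proof.
move=> F0; elim: r => [|i r IH].
  rewrite [X in C0r X](_ : _ = fun=> 0); first exact: C0r0.
  by apply/funext => x; rewrite big_nil.
case Pi : (P i); last first.
  by congr C0r: IH; apply/funext => x; rewrite big_cons Pi.
have := C0rD (F0 _ Pi) IH.
by congr C0r; apply/funext => x; rewrite big_cons Pi.
Qed.

Lemma C0r_norm f : C0r f -> C0r (fun x => `|f x|).
Proof.
move=> f0; have [cf _] := f0; apply: (C0r_dominated _ f0) => x.
  exact: cvg_norm (cf x).
by rewrite normr_id.
Qed.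

Lemma C0r_min f g : C0r f -> C0r g -> C0r (fun x => Num.min (f x) (g x)).
Proof.
move=> f0 g0; rewrite (_ : (fun x => Num.min _ _) = fun x => 2^-1 * (f x + g x - `|f x - g x|)).
  by apply/C0rZ/C0rB; [exact: C0rD|exact/C0r_norm/C0rB].
by apply/funext => x; have [fg|gf] := lerP (f x) (g x); lra.
Qed.

Lemma C0r_max f g : C0r f -> C0r g -> C0r (fun x => Num.max (f x) (g x)).
Proof.
move=> f0 g0; have := C0rN (C0r_min (C0rN f0) (C0rN g0)); congr C0r.
by apply/funext => x; rewrite -oppr_max opprK.
Qed.

End vanishing_functions.

(** * Linear functionals and total variation *)

Section functionals.
Variables (R : realType) (L : topologicalType).
Implicit Types (f g h : L -> R) (m v : (L -> R) -> R).

(** Functionals are total on [L -> R] and constrained on [C0r] only, so that pointwise expressions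
    can be fed to them without packing. *)
Definition linear_C0r m := forall a f g, C0r f -> C0r g ->
  m (fun x => a * f x + g x) = a * m f + m g.

Definition positive_C0r m := forall f, C0r f -> (forall x, 0 <= f x) -> 0 <= m f.

(** [b] runs over all pointwise bounds of [f], so [M] bounds the dual norm without a supremum being
    taken. *)
Definition bounded_C0r M m := forall f b, C0r f -> 0 <= b ->
  (forall x, `|f x| <= b) -> `|m f| <= M * b.

Section linear.
Variable m : (L -> R) -> R.
Hypothesis ml : linear_C0r m.

Lemma lin0 : m (fun=> 0) = 0.
Proof.
have := ml (-1) (@C0r0 R L) (@C0r0 R L).
rewrite (_ : (fun x => _) = fun=> 0); last by apply/funext => x; rewrite mulr0 addr0.
by rewrite mulN1r addNr.
Qed.

Lemma linZ a f : C0r f -> m (fun x => a * f x) = a * m f.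
Proof.
move=> f0; have := ml a f0 (@C0r0 R L); rewrite lin0 addr0 => <-.
by congr m; apply/funext => x; rewrite addr0.
Qed.

Lemma linD f g : C0r f -> C0r g -> m (fun x => f x + g x) = m f + m g.
Proof.
move=> f0 g0; have := ml 1 f0 g0; rewrite mul1r => <-.
by congr m; apply/funext => x; rewrite mul1r.
Qed.

Lemma linN f : C0r f -> m (fun x => - f x) = - m f.
Proof.
move=> f0; rewrite -mulN1r -(linZ _ f0).
by congr m; apply/funext => x; rewrite mulN1r.
Qed.

Lemma linB f g : C0r f -> C0r g -> m (fun x => f x - g x) = m f - m g.
Proof. by move=> f0 g0; rewrite (linD f0 (C0rN g0)) linN. Qed.

Lemma lin_sum (I : Type) (r : seq I) (P : pred I) (F : I -> L -> R) :
  (forall i, P i -> C0r (F i)) ->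
  m (fun x => \sum_(i <- r | P i) F i x) = \sum_(i <- r | P i) m (F i).
Proof.
move=> F0; elim: r => [|i r IH].
  by rewrite big_nil -[RHS]lin0; congr m; apply/funext => x; rewrite big_nil.
rewrite big_cons -IH; case Pi : (P i); last first.
  by congr m; apply/funext => x; rewrite big_cons Pi.
rewrite -linD; [|exact: F0|exact: C0r_sum].
by congr m; apply/funext => x; rewrite big_cons Pi.
Qed.

Hypothesis mp : positive_C0r m.

Lemma lin_mono f g : C0r f -> C0r g -> (forall x, f x <= g x) -> m f <= m g.
Proof.
move=> f0 g0 fg; rewrite -subr_ge0 -linB//; apply: mp; first exact: C0rB.
by move=> x; rewrite subr_ge0.
Qed.

Lemma lin_abs f g : C0r f -> C0r g -> (forall x, `|f x| <= g x) -> `|m f| <= m g.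
Proof.
move=> f0 g0 fg; rewrite ler_norml -linN//; apply/andP; split.
  by apply: lin_mono => //; [exact: C0rN|move=> x; have := fg x; rewrite ler_norml => /andP[]].
by apply: lin_mono => // x; rewrite (le_trans _ (fg x))// ler_norm.
Qed.

Lemma positive_bounded M :
  (forall f b, C0r f -> 0 <= b -> (forall x, 0 <= f x <= b) -> m f <= M * b) ->
  bounded_C0r M m.
Proof.
move=> mM f b f0 b0 fb; apply: (le_trans (lin_abs f0 (C0r_norm f0) _)) => //.
by apply: mM => [|//|x]; [exact: C0r_norm|rewrite normr_ge0 fb].
Qed.

End linear.

(** * The Riesz decomposition of a bounded functional *)

Section positive_part.
Variables (m : (L -> R) -> R) (M : R).
Hypotheses (ml : linear_C0r m) (mb : bounded_C0r M m).

(** Riesz's formula for the positive part of [m], meaningful for nonnegative [h]; [positive_part]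
    extends it by differences. *)
Definition positive_part_cone h :=
  sup [set m g | g in [set g | C0r g /\ forall x, 0 <= g x <= h x]].

Local Notation pv := positive_part_cone.

Let pv_has_sup h : C0r h -> (forall x, 0 <= h x) ->
  has_sup [set m g | g in [set g | C0r g /\ forall x, 0 <= g x <= h x]].
Proof.
move=> h0 hp; split.
  by exists (m (fun=> 0)), (fun=> 0) => //; split=> [|x]; [exact: C0r0|rewrite lexx hp].
have [b b0 hb] := C0r_bounded h0; exists (M * b) => _ [g [g0 gh] <-].
rewrite (le_trans (ler_norm _))//; apply: mb => // x.
by have /andP[gp ghx] := gh x; rewrite ger0_norm// (le_trans ghx)// (le_trans (ler_norm _) (hb x)).
Qed.

Let pv_ge g h : C0r h -> C0r g -> (forall x, 0 <= g x <= h x) -> m g <= pv h.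
Proof.
move=> h0 g0 gh; apply: sup_upper_bound; last by exists g.
by apply: pv_has_sup => // x; have /andP[/le_trans] := gh x; apply.
Qed.

Let pv_le h c : C0r h -> (forall x, 0 <= h x) ->
  (forall g, C0r g -> (forall x, 0 <= g x <= h x) -> m g <= c) -> pv h <= c.
Proof.
move=> h0 hp hc; apply: ge_sup; first by have [] := pv_has_sup h0 hp.
by move=> _ [g [g0 gh] <-]; exact: hc.
Qed.

Let pvD h k : C0r h -> C0r k -> (forall x, 0 <= h x) -> (forall x, 0 <= k x) ->
  pv (fun x => h x + k x) = pv h + pv k.
Proof.
move=> h0 k0 hp kp; have hk0 := C0rD h0 k0; apply/eqP; rewrite eq_le; apply/andP; split.
  apply: pv_le => // [x|g g0 ghk]; first by rewrite addr_ge0.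
  (* Riesz decomposition property: [g <= h + k] splits into [g1 <= h] and [g - g1 <= k]. *)
  pose g1 x := Num.min (g x) (h x).
  have g10 : C0r g1 by exact: C0r_min.
  rewrite (_ : g = fun x => g1 x + (g x - g1 x)); last by apply/funext => x; rewrite subrKC.
  rewrite linD//; last exact: C0rB.
  have gE x := (hp x, kp x, ghk x).
  apply: lerD.
    apply: pv_ge => // x; have [[hx kx] /andP[? ?]] := gE x.
    by rewrite /g1; case: (lerP (g x) (h x)) => ?; apply/andP; split; lra.
  apply: pv_ge => // [|x]; first exact: C0rB.
  have [[hx kx] /andP[? ?]] := gE x.
  by rewrite /g1; case: (lerP (g x) (h x)) => ?; apply/andP; split; lra.
rewrite -lerBrDr; apply: pv_le => // g g0 gh.
rewrite lerBrDr addrC -lerBrDr; apply: pv_le => // g' g'0 gk.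
rewrite lerBrDr addrC -linD//; apply: pv_ge => // [|x]; first exact: C0rD.
have /andP[? ?] := gh x; have /andP[? ?] := gk x.
by apply/andP; split; lra.
Qed.

Let pvZ a h : 0 < a -> C0r h -> (forall x, 0 <= h x) ->
  pv (fun x => a * h x) = a * pv h.
Proof.
have le b k : 0 < b -> C0r k -> (forall x, 0 <= k x) -> pv (fun x => b * k x) <= b * pv k.
  move=> b0 k0 kp; apply: pv_le => [|x|g g0 gh]; first exact: C0rZ.
    by rewrite mulr_ge0// ltW.
  rewrite -ler_pdivrMl// -linZ//; apply: pv_ge => // [|x]; first exact: C0rZ.
  have /andP[gp gk] := gh x.
  by rewrite ler_pdivrMl// gk mulr_ge0// invr_ge0 ltW.
(* The reverse inequality is [le] for the factor [a^-1] and the function [a * h]. *)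
move=> a0 h0 hp; apply/eqP; rewrite eq_le le//= -ler_pdivlMl//.
have ah : h = fun x => a^-1 * (a * h x) by apply/funext => x; rewrite mulKf ?gt_eqF.
rewrite {1}ah; apply: le; first by rewrite invr_gt0.
  exact: C0rZ.
by move=> x; rewrite mulr_ge0// ltW.
Qed.

Definition positive_part h :=
  pv (fun x => Num.max (h x) 0) - pv (fun x => Num.max (- h x) 0).

Local Notation pp := positive_part.

Let p0 h : C0r h -> C0r (fun x => Num.max (h x) 0).
Proof. by move=> h0; apply: C0r_max => //; exact: C0r0. Qed.

Let n0 h : C0r h -> C0r (fun x => Num.max (- h x) 0).
Proof. by move=> h0; apply: C0r_max; [exact: C0rN|exact: C0r0]. Qed.

Let max0 (t : R) : 0 <= Num.max t 0. Proof. by rewrite le_max lexx orbT. Qed.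

(** With [h^+] and [h^-] the two [Num.max] terms, [h^+ + b = h^- + a], and [pv] is additive on the
    cone. Additivity and homogeneity of [positive_part] follow by choosing convenient [a] and
    [b]. *)
Let ppE h a b : C0r a -> C0r b -> (forall x, 0 <= a x) -> (forall x, 0 <= b x) ->
  (forall x, h x = a x - b x) -> pp h = pv a - pv b.
Proof.
move=> a0 b0 ap bp hab; have h0 : C0r h.
  by rewrite (_ : h = fun x => a x - b x); [exact: C0rB|exact/funext].
have : pv (fun x => Num.max (h x) 0) + pv b = pv (fun x => Num.max (- h x) 0) + pv a.
  rewrite -!pvD//; do ?[exact: p0|exact: n0].
  by congr pv; apply/funext => x; rewrite hab; do 2![case: lerP => ?]; lra.
by rewrite /pp; lra.
Qed.

Lemma positive_part_pos h : C0r h -> (forall x, 0 <= h x) -> pp h = pv h.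
Proof.
move=> h0 hp; rewrite (@ppE _ h (fun=> 0))// => [||x]; do ?[exact: C0r0|by rewrite subr0].
suff -> : pv (fun=> 0) = 0 by rewrite subr0.
apply/eqP; rewrite eq_le; apply/andP; split; last first.
  rewrite -[leLHS](lin0 ml); apply: pv_ge => [||x]; do ?[exact: C0r0|by rewrite lexx].
apply: pv_le => // [|g g0 gh]; first exact: C0r0.
rewrite -(lin0 ml) (_ : g = fun=> 0)//; apply/funext => x.
by apply/eqP; rewrite eq_le andbC.
Qed.

Lemma positive_part_linear : linear_C0r pp.
Proof.
have D f g : C0r f -> C0r g -> pp (fun x => f x + g x) = pp f + pp g.
  move=> f0 g0; rewrite (@ppE _ (fun x => Num.max (f x) 0 + Num.max (g x) 0)
    (fun x => Num.max (- f x) 0 + Num.max (- g x) 0)).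
  - by rewrite !pvD; do ?[exact: p0|exact: n0|by move=> x; exact: max0]; rewrite /pp; lra.
  - by apply: C0rD; exact: p0.
  - by apply: C0rD; exact: n0.
  - by move=> x; rewrite addr_ge0.
  - by move=> x; rewrite addr_ge0.
  - by move=> x; do 4![case: lerP => ?]; lra.
have Z a f : 0 < a -> C0r f -> pp (fun x => a * f x) = a * pp f.
  move=> a0 f0; rewrite (@ppE _ (fun x => a * Num.max (f x) 0) (fun x => a * Num.max (- f x) 0)).
  - by rewrite !pvZ//; do ?[exact: p0|exact: n0]; rewrite /pp; lra.
  - by apply: C0rZ; exact: p0.
  - by apply: C0rZ; exact: n0.
  - by move=> x; rewrite mulr_ge0// ltW.
  - by move=> x; rewrite mulr_ge0// ltW.
  - move=> x; rewrite -mulrBr; congr (_ * _).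
    by do 2![case: lerP => ?]; lra.
have N f : pp (fun x => - f x) = - pp f.
  rewrite /pp opprB; congr (_ - pv _).
  by apply/funext => x; rewrite opprK.
move=> a f g f0 g0; rewrite D//; last exact: C0rZ.
congr (_ + _); case: (ltgtP a 0) => [a0|a0|->].
- rewrite -[a]opprK mulNr -Z ?oppr_gt0// -N; congr pp.
  by apply/funext => x; rewrite mulNr.
- exact: Z.
- rewrite mul0r (_ : (fun x => _) = fun=> 0); last by apply/funext => x; rewrite mul0r.
  have := N (fun=> 0); rewrite oppr0.
  by move/eqP; rewrite -subr_eq0 opprK -mulr2n mulrn_eq0 => /eqP.
Qed.

Lemma positive_part_ge0 : positive_C0r pp.
Proof.
move=> h h0 hp; rewrite positive_part_pos// -(lin0 ml); apply: pv_ge => //; first exact: C0r0.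
by move=> x; rewrite lexx hp.
Qed.

Lemma positive_part_ge h : C0r h -> (forall x, 0 <= h x) -> m h <= pp h.
Proof.
by move=> h0 hp; rewrite positive_part_pos//; apply: pv_ge => // x; rewrite lexx hp.
Qed.

Lemma positive_part_le h b : C0r h -> 0 <= b -> (forall x, 0 <= h x <= b) -> pp h <= M * b.
Proof.
move=> h0 b0 hb; have hp x : 0 <= h x by have /andP[] := hb x.
rewrite positive_part_pos//; apply: pv_le => // g g0 gh.
rewrite (le_trans (ler_norm _))//; apply: mb => // x.
by have /andP[gp ghx] := gh x; have /andP[_ hbx] := hb x; rewrite ger0_norm// (le_trans ghx).
Qed.

(** Here [v] is [m^+ + (m^+ - m)], that is [m^+ + m^-], a sum of two positive functionals. The
    constant 3 counts 2 for [2 * pp h] and 1 for [m h]. *)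
Lemma total_variation : exists v, [/\ linear_C0r v, positive_C0r v,
  bounded_C0r (3 * M) v & forall f, C0r f -> `|m f| <= v (fun x => `|f x|)].
Proof.
pose v h := 2 * pp h - m h.
have vl : linear_C0r v.
  by move=> a f g f0 g0; rewrite /v ml// positive_part_linear//; ring.
have vp : positive_C0r v.
  move=> h h0 hp; have := positive_part_ge h0 hp; have := positive_part_ge0 h0 hp.
  by rewrite /v; lra.
exists v; split=> //.
  apply: positive_bounded => // h b h0 b0 hb; have := positive_part_le h0 b0 hb.
  have : `|m h| <= M * b.
    by apply: mb => // x; have /andP[hp ?] := hb x; rewrite ger0_norm.
  by rewrite ler_norml /v => /andP[]; lra.
move=> f f0; have pos h : C0r h -> (forall x, 0 <= h x) -> `|m h| <= v h.
  move=> h0 hp; have := positive_part_ge h0 hp; have := positive_part_ge0 h0 hp.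
  by rewrite /v ler_norml => ? ?; apply/andP; split; lra.
have -> : (fun x => `|f x|) = fun x => Num.max (f x) 0 + Num.max (- f x) 0.
  by apply/funext => x; case: (ger0P (f x)) => ?; do ?[case: lerP => ?]; lra.
have fE : f = fun x => Num.max (f x) 0 - Num.max (- f x) 0.
  by apply/funext => x; do 2![case: lerP => ?]; lra.
rewrite (linD vl (p0 f0) (n0 f0)) {1}fE (linB ml (p0 f0) (n0 f0)).
by rewrite (le_trans (ler_normB _ _))// lerD// pos//; [exact: p0|exact: n0].
Qed.

End positive_part.

Lemma common_total_variation (J : finType) (m : J -> (L -> R) -> R) M : 0 <= M ->
  (forall j, linear_C0r (m j)) -> (forall j, bounded_C0r M (m j)) ->
  exists v, [/\ linear_C0r v, positive_C0r v,
    exists2 M', 0 < M' & bounded_C0r M' v &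
    forall j f, C0r f -> `|m j f| <= v (fun x => `|f x|)].
Proof.
move=> M0 ml mb.
have /choice[v vP] : forall j, exists v, [/\ linear_C0r v, positive_C0r v,
    bounded_C0r (3 * M) v & forall f, C0r f -> `|m j f| <= v (fun x => `|f x|)].
  by move=> j; exact: total_variation.
exists (fun f => \sum_j v j f); split.
- move=> a f g f0 g0; rewrite mulr_sumr -big_split; apply: eq_bigr => j _.
  by have [vl _ _ _] := vP j; rewrite vl.
- by move=> f f0 fp; apply: sumr_ge0 => j _; have [_ vp _ _] := vP j; exact: vp.
(* The added 1 keeps the bound positive even when [J] is empty or [M] is 0. *)
- exists (\sum_(j : J) (3 * M) + 1); first by rewrite ltr_wpDl// sumr_ge0// => j _; lra.
  move=> f b f0 b0 fb; rewrite mulrDl mul1r mulr_suml (le_trans (ler_norm_sum _ _ _))//.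
  rewrite ler_wpDr//; apply: ler_sum => j _.
  by have [_ _ vb _] := vP j; exact: vb.
- move=> j f f0; have [_ _ _ /(_ f f0)/le_trans] := vP j; apply.
  rewrite (bigD1 j)//= lerDl sumr_ge0// => i _; have [_ vp _ _] := vP i.
  by apply: vp => [|x]; [exact: C0r_norm|].
Qed.

End functionals.

(** * Densities *)

Section radon_nikodym.
Variables (R : realType) (L : topologicalType).
Implicit Types (f g h : L -> R).
Variables (v : (L -> R) -> R) (M : R).
Hypotheses (vl : linear_C0r v) (vp : positive_C0r v) (M0 : 0 < M) (vb : bounded_C0r M v).

Lemma approximate_density (m : (L -> R) -> R) (d : R) : linear_C0r m ->
  (forall f, C0r f -> `|m f| <= v (fun x => `|f x|)) -> 0 < d ->
  exists2 g, C0r g & forall h, C0r h -> (forall x, `|h x| <= 1) ->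
    `|m h - v (fun x => g x * h x)| <= d.
Proof.
(* An exact minimizer of [Phi] would be the density of [m] with respect to [v]. *)
move=> ml mv d0; pose Phi g := v (fun x => g x * g x) - 2 * m g.
have Phi_ge g : C0r g -> - M <= Phi g.
  move=> g0; have g1 := C0r_norm g0; have g2 := C0rM g0 g0.
  (* As 2 s - s^2 <= 1, the function k is bounded by 1 whatever the size of g. *)
  pose k x := Num.max (2 * `|g x| - g x * g x) 0.
  have k0 : C0r k by apply: C0r_max; [apply: C0rB => //; exact: C0rZ|exact: C0r0].
  have : 2 * v (fun x => `|g x|) - v (fun x => g x * g x) <= v k.
    rewrite -(linZ vl)// -linB//; last exact: C0rZ.
    apply: lin_mono => //; first by apply: C0rB => //; exact: C0rZ.
    by move=> x; rewrite le_max lexx.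
  have kM : v k <= M.
    apply: (le_trans (ler_norm _)); rewrite -[leRHS]mulr1; apply: vb => // x.
    rewrite /k; have -> : g x * g x = `|g x| * `|g x|.
      by rewrite -normrM ger0_norm// -expr2 sqr_ge0.
    rewrite ger0_norm ?le_max ?lexx ?orbT// ge_max ler01 andbT.
    by have := sqr_ge0 (`|g x| - 1); lra.
  by have := mv _ g0; rewrite ler_norml => /andP[? ?]; rewrite /Phi; lra.
pose E := [set Phi g | g in @C0r R L].
have Einf : has_inf E.
  split; first by exists (Phi (fun=> 0)), (fun=> 0) => //; exact: C0r0.
  by exists (- M) => _ [g g0 <-]; exact: Phi_ge.
(* Moving [g] by [t h] or [- t h] lowers [Phi] by less than [t^2], and the quadratic term is at most
   [t^2 M]; dividing by [2 t] leaves [t (M + 1) / 2], which is below [d]. *)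
pose t := d / (M + 1).
have t0 : 0 < t by rewrite divr_gt0// addr_gt0.
have tE : t * (M + 1) = d by rewrite /t divfK// gt_eqF// addr_gt0.
have [_ [g g0 <-] gt] := inf_adherent (mulr_gt0 t0 t0) Einf.
exists g => // h h0 h1.
have gh0 := C0rM g0 h0; have hh0 := C0rM h0 h0; have gg0 := C0rM g0 g0.
have main s : s * s = 1 -> s * (m h - v (fun x => g x * h x)) <= d.
  move=> s1; pose k x := s * t * h x + g x.
  have k0 : C0r k by apply: C0rD => //; exact: C0rZ.
  have : inf E <= Phi k by apply: inf_lbound; [case: Einf|exists k].
  have -> : Phi k = Phi g + 2 * t * (s * (v (fun x => g x * h x) - m h))
                    + t ^+ 2 * v (fun x => h x * h x).
    rewrite /Phi /k ml// (_ : (fun x => _) = fun x => t ^+ 2 * (h x * h x) +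
      (2 * s * t * (g x * h x) + g x * g x)).
      rewrite (vl _ hh0); last by apply: C0rD => //; exact: C0rZ.
      by rewrite vl//; ring.
    apply/funext => x; have -> : t ^+ 2 = s * s * t ^+ 2 by rewrite s1 mul1r.
    by ring.
  have : v (fun x => h x * h x) <= M.
    apply: (le_trans (ler_norm _)); rewrite -[leRHS]mulr1; apply: vb => // x.
    by rewrite normrM mulr_ile1.
  move: gt tE t0; move: (v _) (v _) (Phi g) (m h) (inf E) => a b c e f.
  nra.
have := main 1; have := main (-1); rewrite mulrNN mul1r => /(_ erefl) ? /(_ erefl) ?.
by rewrite ler_norml; apply/andP; split; lra.
Qed.

End radon_nikodym.

(** * Grids on the line *)

Section grid.
Variable R : realType.

Lemma sum_le1_of_single (I : finType) (F : I -> R) : (forall i, 0 <= F i <= 1) ->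
  (forall i j, F i != 0 -> F j != 0 -> i = j) -> \sum_i F i <= 1.
Proof.
move=> F01 F1; case: (pickP (fun i => F i != 0)) => [i Fi|F0].
  rewrite (bigD1 i)//= big1 ?addr0; first by case/andP: (F01 i).
  by move=> j /eqP ji; apply/eqP; apply: contra_notT ji => /F1; apply.
by rewrite big1 => // i _; have /negbFE/eqP := F0 i.
Qed.

(** For [T > 0] the value is 0 unless [1/T < s < 1 - 1/T], and 1 when [2/T <= s <= 1 - 2/T]. *)
Definition trapezoid (T s : R) : R := Num.max 0 (Num.min 1 (T * Num.min s (1 - s) - 1)).

(** The [N] grids of mesh [w] are successive translates by [w / N]. A box is a cell shrunk at both
    ends, and [q k a] lives on it. For a given [k] the defect [1 - \sum_a q k a t] is nonzero only
    at distance less than [w / (2 N)] from a line of the [k]-th grid; these zones are disjoint for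
    distinct [k], which gives the last clause. *)
Lemma grid (B w : R) (N : nat) : 0 <= B -> 0 < w -> (0 < N)%N ->
  exists p : nat, exists lo hi : 'I_N -> 'I_p -> R, exists q : 'I_N -> 'I_p -> R -> R,
  exists cell : 'I_N -> R -> 'I_p,
  [/\ (forall k a, continuous (q k a)) /\ (forall k a t, 0 <= q k a t <= 1),
      (forall k a t, q k a t != 0 -> lo k a <= t <= hi k a) /\
      (forall k a, hi k a - lo k a <= w),
      forall k a t, lo k a <= t <= hi k a -> cell k t = a,
      forall k t t', `|t| <= B -> `|t'| <= B -> cell k t = cell k t' -> `|t - t'| <= w &
      forall t, `|t| <= B -> \sum_k (1 - \sum_a q k a t) <= 1].
Proof.
move=> B0 w0 N0; pose p := Num.truncn (2 * B / w + 1).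
have NR : 0 < N%:R :> R by rewrite ltr0n.
(* Abscissa in units of [w]. The margin [w] keeps it nonnegative for [|t| <= B] in spite of the
   shift, so that [Num.truncn] is the floor; it is then at most [2 * B / w + 1], whence [p]. *)
pose z (k : 'I_N) t : R := (t + B + w) / w - k%:R / N%:R.
pose x0 (k : 'I_N) : R := - B - w + k%:R / N%:R * w.
pose tau : R := (4 * N%:R)^-1.
have tau0 : 0 < tau by rewrite invr_gt0 mulr_gt0.
have NT : 4 * N%:R * tau = 1 by rewrite mulfV// mulf_neq0// gt_eqF.
pose lo k (a : 'I_p.+1) : R := x0 k + (a%:R + tau) * w.
pose hi k (a : 'I_p.+1) : R := x0 k + (a%:R + 1 - tau) * w.
pose q k (a : 'I_p.+1) t := trapezoid (4 * N%:R) (z k t - a%:R).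
(* Beyond [B] the default value of [inord] may occur, but on a box the integer part is the index [a]
   itself, so boxes are always classified correctly. *)
pose cell k t : 'I_p.+1 := inord (Num.truncn (z k t)).
have zE k t : t = x0 k + z k t * w by rewrite /x0 /z; field; rewrite !gt_eqF.
have q01 k a t : 0 <= q k a t <= 1.
  by rewrite /q /trapezoid le_max lexx/= ge_max ler01 ge_min lexx.
have qbox k a t : q k a t != 0 -> lo k a <= t <= hi k a.
  rewrite /lo /hi [X in _ <= X <= _](zE k t) !lerD2l !ler_pM2r// /q /trapezoid.
  move=> qn0; have : 0 < 4 * N%:R * Num.min (z k t - a%:R) (1 - (z k t - a%:R)) - 1.
    by rewrite ltNge; apply: contraNN qn0 => h; rewrite max_l// ge_min h orbT.
  rewrite subr_gt0 -[X in X < _]NT ltr_pM2l ?mulr_gt0// lt_min => /andP[? ?].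
  by apply/andP; split; lra.
have box_cell k a t : lo k a <= t <= hi k a -> Num.truncn (z k t) = a.
  rewrite /lo /hi [X in _ <= X <= _](zE k t) !lerD2l !ler_pM2r// => /andP[h1 h2].
  by apply: truncn_def; rewrite -natr1; apply/andP; split; lra.
have cellE k t : `|t| <= B -> (cell k t : nat) = Num.truncn (z k t).
  rewrite ler_norml => /andP[t1 t2]; rewrite inordK// ltnS; apply: le_truncn.
  rewrite /z lerBlDr ler_wpDr ?divr_ge0//.
  by rewrite mulrDl divff ?gt_eqF// lerD2r ler_pM2r ?invr_gt0//; lra.
have z_ge0 k t : `|t| <= B -> 0 <= z k t.
  rewrite ler_norml => /andP[t1 t2]; rewrite /z subr_ge0 (@le_trans _ _ 1)//.
    by rewrite ler_pdivrMr// mul1r ler_nat ltnW.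
  by rewrite ler_pdivlMr// mul1r; lra.
exists p.+1, lo, hi, q, cell; split=> //.
- split=> // k a.
  have mx (f g : R -> R) : continuous f -> continuous g ->
      continuous (fun t => Num.max (f t) (g t)).
    by move=> cf cg t; exact: continuous_max (cf t) (cg t).
  have mn (f g : R -> R) : continuous f -> continuous g ->
      continuous (fun t => Num.min (f t) (g t)).
    by move=> cf cg t; exact: continuous_min (cf t) (cg t).
  have zc : continuous (fun t => z k t - a%:R).
    move=> t; apply: cvgB; last exact: cvg_cst.
    apply: cvgB; last exact: cvg_cst.
    apply: cvgM; last exact: cvg_cst.
    by do 2![apply: cvgD; last exact: cvg_cst].
  apply: mx; first exact: cst_continuous.
  apply: (mn (fun=> 1)); first exact: cst_continuous.
  move=> t; apply: cvgB; last exact: cvg_cst; apply: cvgM; first exact: cvg_cst.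
  apply: (mn (fun t => z k t - a%:R) (fun t => 1 - (z k t - a%:R))) => // {}t.
  by apply: cvgB (zc t); exact: cvg_cst.
- split=> // k a; rewrite /hi /lo.
  by have := mulr_gt0 tau0 w0; lra.
- by move=> k a t /box_cell tE; rewrite /cell tE inord_val.
- move=> k t t' tB t'B /(congr1 val)/=; rewrite !cellE// => e.
  have /andP[h1 h2] := truncn_itv (z_ge0 k t tB).
  have /andP[] := truncn_itv (z_ge0 k t' t'B); rewrite -e => h3 h4.
  rewrite (zE k t) (zE k t') opprD addrACA subrr add0r -mulrBl normrM (gtr0_norm w0).
  rewrite ler_piMl ?(ltW w0)// ler_norml; move: h2 h4; rewrite -natr1.
  by move=> ? ?; apply/andP; split; lra.
move=> t tB; have sumE k : \sum_a q k a t = q k (cell k t) t.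
  rewrite (bigD1 (cell k t))//= big1 ?addr0// => a /eqP ac.
  apply/eqP; apply: contra_notT ac => /qbox/box_cell e.
  by apply/val_inj; rewrite /= cellE.
have bad k : 1 - \sum_a q k a t != 0 -> exists n : nat, `|z k t - n%:R| < 2 * tau.
  rewrite sumE => qn1; set c : R := (cell k t)%:R.
  have cz : c <= z k t < c + 1 by rewrite /c natr1 cellE// truncn_itv// z_ge0.
  have : Num.min (z k t - c) (1 - (z k t - c)) < 2 * tau.
    rewrite ltNge; apply: contraNN qn1 => h.
    rewrite /q /trapezoid min_l ?max_r ?subrr//.
    by rewrite lerBrDr -ler_pdivrMl ?mulr_gt0// (le_trans _ h)// /tau; lra.
  rewrite gt_min => /orP[h|h]; [exists (cell k t)|exists (cell k t).+1].
    by rewrite ltr_norml; case/andP: cz => ? ?; apply/andP; split; rewrite -/c; lra.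
  by rewrite ltr_norml -natr1 -/c; case/andP: cz => ? ?; apply/andP; split; lra.
apply: sum_le1_of_single => [k|k k'].
  by rewrite sumE subr_ge0 lerBlDr; have /andP[? ?] := q01 k (cell k t) t; apply/andP; split; lra.
move=> /bad[n hn] /bad[n' hn'].
(* If [t] is close to a line of both grids, these lines, measured in units of [w / N], sit at
   integers less than 1 apart; they are equal, and reduction modulo [N] identifies the shifts. *)
have : `|(k + n * N)%:R - (k' + n' * N)%:R : R| < 1.
  have -> : (k + n * N)%:R - (k' + n' * N)%:R =
      N%:R * ((z k' t - n'%:R) - (z k t - n%:R)) :> R.
    by rewrite /z !natrD !natrM; field; rewrite !gt_eqF.
  rewrite normrM (gtr0_norm NR) (@lt_le_trans _ _ (N%:R * (2 * tau + 2 * tau)))//.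
    by rewrite ltr_pM2l// (le_lt_trans (ler_normB _ _))// ltrD.
  by move: NT; lra.
wlog le : k k' n n' {hn hn'} / (k + n * N <= k' + n' * N)%N.
  have /orP[le h|le h dist] := leq_total (k + n * N) (k' + n' * N); first exact: h.
  by apply/esym/(h _ _ _ _ le); rewrite distrC.
rewrite distrC -natrB// ger0_norm ?ler0n// -[1]/(1%:R) ltr_nat ltnS leqn0 subn_eq0 => ge.
have /(congr1 (modn^~ N)) : (n * N + k = n' * N + k')%N.
  by apply/eqP; rewrite eqn_leq ![(_ * N + _)%N]addnC le.
by rewrite !modnMDl !modn_small// => /val_inj.
Qed.

End grid.

(** * Partitions of unity subordinate to boxes *)

Section boxes.
Variables (R : realType) (C : finType).
Implicit Types (lo hi y : C -> R).

Definition in_box lo hi y := forall c, lo c <= y c <= hi c.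

(** The l1 distance from [y] to the box, when [lo <= hi]. *)
Definition box_dist lo hi y :=
  \sum_c (Num.max 0 (lo c - y c) + Num.max 0 (y c - hi c)).

Lemma box_dist_ge0 lo hi y : 0 <= box_dist lo hi y.
Proof. by apply: sumr_ge0 => c _; rewrite addr_ge0// le_max lexx. Qed.

Lemma box_dist_coord lo hi y c :
  lo c - box_dist lo hi y <= y c <= hi c + box_dist lo hi y.
Proof.
have : Num.max 0 (lo c - y c) + Num.max 0 (y c - hi c) <= box_dist lo hi y.
  rewrite /box_dist (bigD1 c)//= lerDl.
  by apply: sumr_ge0 => i _; rewrite addr_ge0// le_max lexx.
move: (box_dist _ _ _) => D.
by case: (lerP 0 (lo c - y c)) => ?; case: (lerP 0 (y c - hi c)) => ? ?;
  apply/andP; split; lra.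
Qed.

Lemma box_dist_eq0 lo hi y : box_dist lo hi y = 0 <-> in_box lo hi y.
Proof.
split=> [d0 c|yb]; first by have := box_dist_coord lo hi y c; rewrite d0 subr0 addr0.
rewrite /box_dist big1// => c _; have /andP[? ?] := yb c.
by rewrite !max_l ?addr0// subr_le0.
Qed.

(** Each coordinate contributes two excesses, each at most [w]. *)
Lemma box_dist_le lo hi y w : 0 <= w -> (forall c, lo c - w <= y c <= hi c + w) ->
  box_dist lo hi y <= (2 * #|C|)%:R * w.
Proof.
move=> w0 yw; apply: (@le_trans _ _ (\sum_(c : C) 2 * w)).
  apply: ler_sum => c _; have /andP[? ?] := yw c.
  by case: (lerP 0 (lo c - y c)) => ?; case: (lerP 0 (y c - hi c)) => ?; lra.
by rewrite sumr_const -(mulr_natr _ #|C|) natrM mulrAC.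
Qed.

Lemma cvg_max0 (T : Type) (F : set_system T) (f : T -> R) (a : R) : Filter F ->
  f @ F --> a -> Num.max 0 (f x) @[x --> F] --> Num.max 0 a.
Proof.
move=> FF fa; under eq_fun do rewrite maxr_absE; rewrite maxr_absE.
apply: cvgM; last exact: cvg_cst.
apply: cvgD; first by apply: cvgD fa; exact: cvg_cst.
by apply: cvg_norm; apply: cvgB fa; exact: cvg_cst.
Qed.

Lemma cvg_box_dist lo hi y (T : Type) (F : set_system T) (u : C -> T -> R) :
  Filter F -> (forall c, u c @ F --> y c) ->
  box_dist lo hi (fun c => u c x) @[x --> F] --> box_dist lo hi y.
Proof.
move=> FF uy; apply: cvg_big => [|c _]; first exact: add_continuous.
apply: cvgD; apply: cvg_max0; first by apply: cvgB (uy c); exact: cvg_cst.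
by apply: cvgB (uy c) _; exact: cvg_cst.
Qed.

End boxes.

Section box_partition.
Variables (R : realType) (C : finType) (J : finType) (lo hi : J -> C -> R) (r : R).
Hypothesis r0 : 0 < r.
Hypothesis boxes_disjoint : forall i j y,
  in_box (lo i) (hi i) y -> in_box (lo j) (hi j) y -> i = j.

Local Notation D j y := (box_dist (lo j) (hi j) y).

(** The first factor kills the weight at distance [r] or more from box [j], the product kills it on
    all the other boxes; normalizing therefore gives exactly 0 or 1 on the boxes. *)
Definition box_weight (j : J) (y : C -> R) :=
  Num.max 0 (r - D j y) * \prod_(i | i != j) D i y.

Definition box_bump (j : J) (y : C -> R) :=
  box_weight j y / \sum_i box_weight i y.

Lemma box_weight_ge0 j y : 0 <= box_weight j y.
Proof.
rewrite mulr_ge0 ?le_max ?lexx//.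
by apply: prodr_ge0 => i _; exact: box_dist_ge0.
Qed.

(** If [y] lies in a box, disjointness makes its distance to the others positive and the weight of
    that box is positive. Otherwise all distances are positive and the weight of [j] is. *)
Lemma box_weight_sum_gt0 j y : D j y < r -> 0 < \sum_i box_weight i y.
Proof.
move=> Dj; suff [i Di Dn] : exists2 i, D i y < r & forall k, k != i -> 0 < D k y.
  have Wi : 0 < box_weight i y.
    by rewrite mulr_gt0 ?prodr_gt0// lt_max subr_gt0 Di orbT.
  by rewrite (bigD1 i)//= ltr_pwDl// sumr_ge0// => k _; exact: box_weight_ge0.
have [[i iy]|noy] := pselect (exists i, in_box (lo i) (hi i) y).
  exists i; first by have /box_dist_eq0 -> := iy.
  move=> k /eqP ki; rewrite lt0r box_dist_ge0 andbT; apply/eqP => /box_dist_eq0 ky.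
  exact/ki/(boxes_disjoint ky iy).
exists j => // k _; rewrite lt0r box_dist_ge0 andbT; apply/eqP => /box_dist_eq0 ky.
by apply: noy; exists k.
Qed.

Lemma box_bump_ge0 j y : 0 <= box_bump j y.
Proof.
by rewrite divr_ge0 ?box_weight_ge0// sumr_ge0// => i _; exact: box_weight_ge0.
Qed.

Lemma box_bump_sum j y : D j y < r -> \sum_i box_bump i y = 1.
Proof.
by move=> /box_weight_sum_gt0 S0; rewrite -mulr_suml mulfV// gt_eqF.
Qed.

Lemma box_bump_neq0 j y : box_bump j y != 0 -> D j y < r.
Proof.
apply: contraNT; rewrite -leNgt => rD.
by rewrite /box_bump /box_weight max_l ?mul0r// subr_le0.
Qed.

Lemma box_bump_in_box j y : in_box (lo j) (hi j) y -> forall i, box_bump i y = (i == j)%:R.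
Proof.
move=> /box_dist_eq0 jy i.
have W0 k : k != j -> box_weight k y = 0.
  by move=> kj; rewrite /box_weight (bigD1 j) 1?eq_sym//= jy mul0r mulr0.
have [->|ij] := eqVneq i j; last by rewrite /box_bump W0// mul0r.
have S0 : 0 < \sum_i box_weight i y by apply: (@box_weight_sum_gt0 j); rewrite jy.
move: S0; rewrite /box_bump (bigD1 j)//= [X in _ + X]big1 ?addr0//.
by move=> S0; rewrite divff// gt_eqF.
Qed.

(** Stated for any filter: [nbhs x] gives continuity and [at_infinity] gives vanishing. The box [i]
    near the limit keeps the denominator away from 0. *)
Lemma cvg_box_bump j y i (T : Type) (F : set_system T) (u : C -> T -> R) :
  Filter F -> (forall c, u c @ F --> y c) -> D i y < r ->
  box_bump j (fun c => u c x) @[x --> F] --> box_bump j y.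
Proof.
move=> FF uy Di.
have cW k : box_weight k (fun c => u c x) @[x --> F] --> box_weight k y.
  apply: cvgM; last first.
    by apply: cvg_big => [|l _]; [exact: mul_continuous|exact: cvg_box_dist].
  by apply: cvg_max0; apply: cvgB; [exact: cvg_cst|exact: cvg_box_dist].
apply: cvgM => //; apply: cvgV; first by rewrite gt_eqF// (box_weight_sum_gt0 Di).
by apply: cvg_big => [|k _]; [exact: add_continuous|exact: cW].
Qed.

End box_partition.

(** * Bump functions and functionals attached to the cells *)

Section clusters.
Variables (R : realType) (L : topologicalType) (C : finType) (u : C -> L -> R).
Hypothesis u0 : forall c, C0r (u c).

Lemma sum_option (I : finType) (F : option I -> R) :
  \sum_o F o = F None + \sum_i F (Some i).
Proof.
rewrite (bigD1 None)//=; congr (_ + _).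
rewrite (reindex_omap Some id) //=; last by case.
by apply: eq_bigl => i; rewrite eqxx.
Qed.

(** The index [None] stands for the degenerate box reduced to the origin. Its bump is 1 at the
    origin, so the others vanish there; since [u] tends to 0 at infinity, so do they. Where the
    remaining bumps do not add up to 1 the bump of [None] is active, hence [u] is small. *)
Lemma cluster_partition (I : finType) (lo hi : I -> C -> R) (w : R) : 0 < w ->
  (forall i j y, in_box (lo i) (hi i) y -> in_box (lo j) (hi j) y -> i = j) ->
  (forall i, ~ in_box (lo i) (hi i) (fun=> 0)) ->
  (forall x, (exists i, forall c, lo i c - w <= u c x <= hi i c + w) \/
             forall c, `|u c x| <= w) ->
  exists phi : I -> L -> R,
  [/\ forall i, C0r (phi i),
      (forall i x, 0 <= phi i x) /\ (forall x, \sum_i phi i x <= 1),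
      forall i x, in_box (lo i) (hi i) (u^~ x) -> forall j, phi j x = (j == i)%:R,
      forall i x c, phi i x != 0 ->
        lo i c - (2 * #|C|).+1%:R * w <= u c x <= hi i c + (2 * #|C|).+1%:R * w &
      forall x c, \sum_i phi i x != 1 -> `|u c x| <= (2 * #|C|).+1%:R * w].
Proof.
(* The factor exceeds by one that of [box_dist_le], so every point is at distance strictly less than
   [r] from some box. *)
move=> w0 disj zero cover; set r := _ * w.
have r0 : 0 < r by rewrite mulr_gt0.
pose lo' (o : option I) c := if o is Some i then lo i c else 0.
pose hi' (o : option I) c := if o is Some i then hi i c else 0.
have nbox y : in_box (lo' None) (hi' None) y -> y = fun=> 0.
  by move=> y0; apply/funext => c; apply/eqP; rewrite eq_le andbC; exact: y0.
have disj' i j y : in_box (lo' i) (hi' i) y -> in_box (lo' j) (hi' j) y -> i = j.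
  case: i j => [i|] [j|] //; first by move=> iy jy; congr Some; exact: disj iy jy.
    by move=> + /nbox y0; rewrite y0 => /zero.
  by move=> /nbox -> /zero.
have bnd (t : R) : 0 <= t -> forall c x, `|u c x| <= t ->
    lo' None c - t <= u c x <= hi' None c + t.
  by move=> t0 c x /=; rewrite sub0r add0r ler_norml.
have cov x : exists o, box_dist (lo' o) (hi' o) (u^~ x) < r.
  have h (D : R) : D <= (2 * #|C|)%:R * w -> D < r.
    by move=> /le_lt_trans; apply; rewrite /r ltr_pM2r// ltr_nat.
  case: (cover x) => [[i ix]|x0]; [exists (Some i)|exists None]; apply: h.
    by apply: box_dist_le ix; exact: ltW.
  by apply: box_dist_le => [|c]; [exact: ltW|apply: bnd => //; exact: ltW].
pose Phi o y := box_bump lo' hi' r o y.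
pose phi i x := Phi (Some i) (u^~ x).
have sumPhi x : Phi None (u^~ x) + \sum_i phi i x = 1.
  have [o ox] := cov x; rewrite -(sum_option (fun o => Phi o (u^~ x))).
  by rewrite (box_bump_sum r0 disj' ox).
have Phi_ge0 o y : 0 <= Phi o y by exact: box_bump_ge0.
exists phi; split.
- move=> i; split=> [x|].
    have [o ox] := cov x.
    exact: (@cvg_box_bump _ _ _ lo' hi' r r0 disj' (Some i) (u^~ x) o L (nbhs x) u
      _ (fun c => (u0 c).1 x) ox).
  have z0 : box_dist (lo' None) (hi' None) (fun=> 0) = 0.
    by apply/box_dist_eq0 => c; rewrite /= lexx.
  have Phi0 : Phi (Some i) (fun=> 0) = 0.
    by rewrite /Phi (box_bump_in_box r0 disj' (proj1 (box_dist_eq0 _ _ _) z0)).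
  have ltz : box_dist (lo' None) (hi' None) (fun=> 0) < r by rewrite z0.
  rewrite -Phi0.
  exact: (@cvg_box_bump _ _ _ lo' hi' r r0 disj' (Some i) _ None L _ u
    _ (fun c => (u0 c).2) ltz).
- split=> [i x|x]; first exact: Phi_ge0.
  by rewrite -(sumPhi x) lerDr; exact: Phi_ge0.
- move=> i x ix j; rewrite /phi /Phi.
  by rewrite (box_bump_in_box r0 disj' (_ : in_box (lo' (Some i)) (hi' (Some i)) _)).
- move=> i x c /box_bump_neq0.
  have := box_dist_coord (lo' (Some i)) (hi' (Some i)) (u^~ x) c.
  by move: (box_dist _ _ _) => D /= /andP[? ?] ?; apply/andP; split; lra.
- move=> x c s1; have : Phi None (u^~ x) != 0.
    by apply: contraNN s1 => /eqP p0; have := sumPhi x; rewrite p0 add0r => ->.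
  move=> /box_bump_neq0; have := box_dist_coord (lo' None) (hi' None) (u^~ x) c.
  rewrite ler_norml; move: (box_dist _ _ _) => D /= /andP[? ?] ?.
  by apply/andP; split; lra.
Qed.

Variables (v : (L -> R) -> R).
Hypotheses (vl : linear_C0r v) (vp : positive_C0r v).

(* When [v psi] vanishes, averaging against [psi] is replaced by evaluation at
   a point of the cell. *)
Lemma cluster_functional (psi : L -> R) (lo hi : C -> R) (x0 : L) :
  C0r psi -> (forall x, 0 <= psi x) -> (forall x, psi x != 0 -> in_box lo hi (u^~ x)) ->
  exists lo' hi' lam, [/\ linear_C0r lam,
    forall h b, C0r h -> (forall x, in_box lo' hi' (u^~ x) -> h x <= b) -> lam h <= b,
    forall h, C0r h -> v (fun x => psi x * h x) = v psi * lam h &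
    ([/\ lo' = lo, hi' = hi & exists x1, in_box lo hi (u^~ x1)] \/
     [/\ v psi = 0, lo' = u^~ x0 & hi' = u^~ x0])].
Proof.
move=> psi0 psip psi_box; have [vpsi|vpsi] := eqVneq (v psi) 0.
  exists (u^~ x0), (u^~ x0), (fun h => h x0); split=> //; last by right.
    by move=> h b h0; apply => c; rewrite lexx.
  move=> h h0; rewrite vpsi mul0r; have [b b0 hb] := C0r_bounded h0.
  apply/eqP; rewrite -normr_le0 -[leRHS](mulr0 b) -vpsi -(linZ vl)//.
  apply: lin_abs => //; [exact: C0rM|exact: C0rZ|move=> x].
  by rewrite normrM (ger0_norm (psip x)) mulrC ler_wpM2r.
have vpsi0 : 0 < v psi by rewrite lt0r vpsi; exact: vp.
exists lo, hi, (fun h => v (fun x => psi x * h x) / v psi); split.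
- move=> a f g f0 g0; rewrite mulrA -mulrDl -vl; do ?exact: C0rM.
  by congr (v _ / _); apply/funext => x; ring.
- move=> h b h0 hb; rewrite ler_pdivrMr// -(linZ vl)//.
  apply: lin_mono => //; [exact: C0rM|exact: C0rZ|move=> x].
  rewrite mulrC; have [->|px] := eqVneq (psi x) 0; first by rewrite !mulr0.
  by rewrite ler_wpM2r// hb//; exact: psi_box.
- by move=> h h0; rewrite mulrC divfK.
- left; split=> //; apply/not_existsP => nx.
  move/eqP: vpsi; apply; rewrite -(lin0 vl); congr v; apply/funext => x.
  by apply/eqP; apply: contra_notT (nx x); exact: psi_box.
Qed.

End clusters.

(** * The projection on real functions *)

Section localized_projection.
Variables (R : realType) (L : topologicalType) (v : (L -> R) -> R).
Hypotheses (vl : linear_C0r v) (vp : positive_C0r v).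

(** A union bound: the defect of a product of cutoffs is controlled coordinate by coordinate. *)
Lemma sub_prod_le_sum (I : Type) (s : seq I) (F : I -> R) :
  (forall i, 0 <= F i <= 1) ->
  0 <= \prod_(i <- s) F i <= 1 /\ 1 - \prod_(i <- s) F i <= \sum_(i <- s) (1 - F i).
Proof.
move=> F01; elim: s => [|i s [/andP[p0 p1] IH]].
  by rewrite !big_nil subrr lexx ler01.
rewrite !big_cons; move: p0 p1 IH; move: (\prod_(_ <- _) _) (\sum_(_ <- _) _) => P S p0 p1 IH.
by have /andP[? ?] := F01 i; split; [apply/andP; split|]; nra.
Qed.

Lemma good_shift (N p : nat) (q : 'I_N -> 'I_p -> R -> R) (G f : L -> R) :
  (0 < N)%N -> (forall k a, continuous (q k a)) ->
  (forall k t, 0 <= \sum_a q k a t <= 1) ->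
  C0r G -> (forall x, 0 <= G x) -> continuous f ->
  (forall x, \sum_k (1 - \sum_a q k a (f x)) <= 1) ->
  exists k, C0r (fun x => G x * (1 - \sum_a q k a (f x))) /\
    N%:R * v (fun x => G x * (1 - \sum_a q k a (f x))) <= v G.
Proof.
move=> N0 qc q01 G0 Gp fc fq; pose E k x := G x * (1 - \sum_a q k a (f x)).
have E0 k : C0r (E k).
  rewrite (_ : E k = fun x => (1 - \sum_a q k a (f x)) * G x); last first.
    by apply/funext => x; rewrite mulrC.
  apply: (@C0rMb _ _ _ _ 1) => // [x|x].
    apply: cvgB; first exact: cvg_cst.
    apply: cvg_big => [|a _]; first exact: add_continuous.
    exact: (continuous_comp (fc x) (qc k a (f x))).
  by have /andP[? ?] := q01 k (f x); rewrite ler_norml; apply/andP; split; lra.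
(* The N boundary zones share the mass of G, so one of them gets at most 1/N. *)
suff [k vk] : exists k, N%:R * v (E k) <= v G by exists k; split; [exact: E0|].
apply/not_existsP => noE.
have : \sum_(k < N) v (E k) <= v G.
  rewrite -(lin_sum vl)//; apply: lin_mono => // [|x]; first exact: C0r_sum.
  by rewrite -mulr_sumr ler_piMr.
suff : v G < \sum_(k < N) v (E k) by lra.
have -> : v G = \sum_(k < N) (N%:R^-1 * v G).
  by rewrite sumr_const card_ord -(mulr_natl (_ * _) N) mulVKf// pnatr_eq0 -lt0n.
apply: ltr_sum => [|k _]; first by apply/hasP; exists (Ordinal N0); rewrite ?mem_index_enum.
by rewrite ltr_pdivrMl ?ltr0n// ltNge; apply/negP.
Qed.

(** As [b] is the [psi v]-average of [h], the function [psi * (b - h)] has [v]-integral 0. Only the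
    deviation of [k] from [a * (b - h)] contributes. *)
Lemma cell_defect (psi h k : L -> R) (a b d : R) :
  C0r psi -> (forall x, 0 <= psi x) -> C0r h -> C0r k ->
  v (fun x => psi x * h x) = v psi * b ->
  (forall x, psi x != 0 -> `|k x - a * (b - h x)| <= d) ->
  `|v (fun x => psi x * k x)| <= d * v psi.
Proof.
move=> psi0 psip h0 k0 vh kd.
pose s x := a * (b * psi x - psi x * h x).
have bs0 : C0r (fun x => b * psi x - psi x * h x) by apply: C0rB; [exact: C0rZ|exact: C0rM].
have s0 : C0r s by exact: C0rZ.
have vs : v s = 0.
  rewrite (linZ vl)// (linB vl) ?(linZ vl)//; [|exact: C0rZ|exact: C0rM].
  by rewrite vh [b * _]mulrC subrr mulr0.
have pk0 : C0r (fun x => psi x * k x) by exact: C0rM.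
rewrite -[v _]subr0 -vs -(linB vl)// -(linZ vl)//.
apply: lin_abs => //; [exact: C0rB|exact: C0rZ|move=> x].
have [p0|p0] := eqVneq (psi x) 0; first by rewrite /s p0 !(mul0r, mulr0) subr0 mulr0 subr0 normr0.
rewrite (_ : _ - _ = (k x - a * (b - h x)) * psi x); last by rewrite /s; ring.
by rewrite normrM (ger0_norm (psip x)) ler_wpM2r// kd.
Qed.

Variables (M : R) (C : finType) (u : C -> L -> R).
Hypotheses (M0 : 0 < M) (vb : bounded_C0r M v) (u0 : forall c, C0r (u c)).

Lemma localized_projection (eps : R) (c0 : C) (x0 : L) : 0 < eps -> 1 <= `|u c0 x0| ->
  exists (I : finType) (phi : I -> L -> R) (lam : I -> (L -> R) -> R),
  [/\ [/\ forall i, C0r (phi i), forall i x, 0 <= phi i x & forall x, \sum_i phi i x <= 1],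
      (forall i, linear_C0r (lam i)) /\
      (forall i h b, C0r h -> (forall x, h x <= b) -> lam i h <= b),
      (forall i j, lam i (phi j) = (j == i)%:R) /\ inhabited I,
      forall c x, `|\sum_i lam i (u c) * phi i x - u c x| <= eps &
      forall c h, C0r h -> (forall x, `|h x| <= 1) ->
        `|v (fun x => u c x * (\sum_i lam i h * phi i x - h x))| <= eps].
Proof.
move=> eps0 ux0.
have [B B0 uB] : exists2 B, 0 <= B & forall c x, `|u c x| <= B.
  have /choice[b bP] : forall c, exists b, 0 <= b /\ forall x, `|u c x| <= b.
    by move=> c; have [b b0 ub] := C0r_bounded (u0 c); exists b.
  exists (\sum_c b c) => [|c x]; first by apply: sumr_ge0 => c _; case: (bP c).
  rewrite (le_trans ((bP c).2 x))// (bigD1 c)//= lerDl.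
  by apply: sumr_ge0 => i _; case: (bP i).
(* The boundary defects need not vanish at infinity; multiplied by [G] they do, and [G] dominates
   every [|u c|]. *)
pose G x := \sum_c `|u c x|.
have G0 : C0r G by apply: C0r_sum => c _; exact: C0r_norm.
have Gp x : 0 <= G x by exact: sumr_ge0.
(* The bound 1/2 puts [x0] outside the cell of the origin, so that [I] is inhabited; the second
   serves the pointwise estimate, the third the two errors [2 * w * M] below. *)
pose w := Num.min 2^-1 (Num.min (eps / (2 * #|C|).+2%:R) (eps / (8 * M))).
have w0 : 0 < w by rewrite !lt_min invr_gt0 ltr0n /= !divr_gt0 ?mulr_gt0.
have w1 : w < 1 by rewrite (@le_lt_trans _ _ 2^-1)// ?ge_min ?lexx// invf_lt1//; lra.
have weps : (2 * #|C|).+2%:R * w <= eps.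
  by rewrite mulrC -ler_pdivlMr// !ge_min lexx orbT.
have wM : 4 * w * M <= eps / 2.
  have : w <= eps / (8 * M) by rewrite !ge_min lexx !orbT.
  by rewrite ler_pdivlMr ?mulr_gt0//; lra.
(* Enough shifts for the boundary zones of all coordinates to cost at most [eps / 2] in total. *)
pose N := (Num.truncn (4 * #|C|%:R * v G / eps)).+1.
have NP : 2 * #|C|%:R * v G <= N%:R * (eps / 2).
  have := ltW (truncnS_gt (4 * #|C|%:R * v G / eps)).
  by rewrite ler_pdivrMr// -/N; lra.
have [p [lo [hi [q [cell [[qc q01] [qbox boxw] box_cell cellw q_bad]]]]]] :=
  grid B0 w0 (ltn0Sn _ : (0 < N)%N).
have q_sum k t : 0 <= \sum_a q k a t <= 1.
  rewrite sumr_ge0; last by move=> a _; case/andP: (q01 k a t).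
  apply: sum_le1_of_single => // a a' qa qa'.
  by rewrite -(box_cell _ _ _ (qbox _ _ _ qa)) -(box_cell _ _ _ (qbox _ _ _ qa')).
have /choice[k kP] : forall c, exists k, C0r (fun x => G x * (1 - \sum_a q k a (u c x))) /\
    N%:R * v (fun x => G x * (1 - \sum_a q k a (u c x))) <= v G.
  by move=> c; apply: good_shift => // [|x]; [case: (u0 c)|exact: q_bad].
pose cellv (y : C -> R) : {ffun C -> 'I_p} := [ffun c => cell (k c) (y c)].
pose psi (al : {ffun C -> 'I_p}) x := \prod_c q (k c) (al c) (u c x).
have psi01 al x : 0 <= psi al x <= 1.
  by have [] := sub_prod_le_sum (index_enum C)
    (fun c => q01 (k c) (al c) (u c x)).
have psi_ge0 al x : 0 <= psi al x by case/andP: (psi01 al x).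
pose boxlo (al : {ffun C -> 'I_p}) c := lo (k c) (al c).
pose boxhi (al : {ffun C -> 'I_p}) c := hi (k c) (al c).
have psi_box al x : psi al x != 0 -> in_box (boxlo al) (boxhi al) (u^~ x).
  by move=> /prodf_neq0 h c; apply/qbox/h.
have box_cellv al y : in_box (boxlo al) (boxhi al) y -> cellv y = al.
  by move=> aly; apply/ffunP => c; rewrite ffunE; exact: box_cell (aly c).
have cellv_w x y c : (forall c, `|y c| <= B) -> cellv (u^~ x) = cellv y -> `|u c x - y c| <= w.
  by move=> yB /ffunP/(_ c); rewrite !ffunE; exact: cellw.
have cellv_uw x x' c : cellv (u^~ x) = cellv (u^~ x') -> `|u c x - u c x'| <= w.
  by apply: (@cellv_w x (u^~ x')) => c'; exact: uB.
pose al0 := cellv (fun=> 0).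
have cellv_0w x c : cellv (u^~ x) = al0 -> `|u c x| <= w.
  by move=> /(@cellv_w _ _ c); rewrite subr0; apply => c'; rewrite normr0.
have psic al : continuous (psi al).
  move=> x; apply: cvg_big => [|c _]; first exact: mul_continuous.
  by apply: (continuous_comp _ (qc _ _ _)); case: (u0 c) => + _; apply.
(* A cell other than that of the origin has a coordinate cutoff vanishing at 0, so [psi al] tends to
   0 along with [u]. *)
have psi0 al : al != al0 -> C0r (psi al).
  move=> al_n0; split=> //.
  have [c qc0] : exists c, q (k c) (al c) 0 = 0.
    apply/not_existsP => nc; move/eqP: al_n0; apply; apply/ffunP => c.
    rewrite ffunE; apply/esym/box_cell/qbox/eqP; exact: nc.
  have <- : \prod_c q (k c) (al c) 0 = 0 by rewrite (bigD1 c)//= qc0 mul0r.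
  apply: cvg_big => [|c' _]; first exact: mul_continuous.
  by apply: continuous_cvg; [exact: qc|case: (u0 c')].
pose P (al : {ffun C -> 'I_p}) := `[< exists x, cellv (u^~ x) = al >] && (al != al0).
pose I : finType := {al | P al}.
have Pn0 (i : I) : val i != al0 by case: i => al /= /andP[].
have Pex (i : I) : exists x, cellv (u^~ x) = val i by case: i => al /= /andP[/asboolP].
(* The alternative [v (psi (val i)) = 0] is the case of point evaluation. The third clause makes the
   boxes disjoint and keeps them off the origin; the last one, that a cell stays within [w] of its
   box, provides the covering needed by [cluster_partition]. *)
pose spec (i : I) (d : (C -> R) * (C -> R) * ((L -> R) -> R)) :=
  let: (lo', hi', lam) := d in
  [/\ linear_C0r lam /\
      (forall h b, C0r h -> (forall x, in_box lo' hi' (u^~ x) -> h x <= b) -> lam h <= b),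
      (forall h, C0r h -> v (fun x => psi (val i) x * h x) = v (psi (val i)) * lam h) /\
      (v (psi (val i)) = 0 \/ forall x, psi (val i) x != 0 -> in_box lo' hi' (u^~ x)),
      forall y, in_box lo' hi' y -> cellv y = val i,
      (forall c, hi' c - lo' c <= w) &
      forall x, cellv (u^~ x) = val i -> forall c, lo' c - w <= u c x <= hi' c + w].
have /choice[d dP] : forall i : I, exists d, spec i d.
  move=> i; have [xi xiP] := Pex i.
  have [lo' [hi' [lam [laml lamb vlam]]]] :=
    cluster_functional vl vp xi (psi0 _ (Pn0 i)) (psi_ge0 _) (psi_box _).
  case=> [[elo ehi [x1 x1P]]|[vpsi elo ehi]]; subst lo' hi'.
    exists (boxlo (val i), boxhi (val i), lam); split.
    - by split.
    - by split=> //; right; exact: psi_box.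
    - by move=> y; exact: box_cellv.
    - by move=> c; exact: boxw.
    - move=> x xi' c; have := cellv_uw x x1 c; rewrite xi' (box_cellv _ _ x1P) => /(_ erefl).
      by have /andP[? ?] := x1P c; rewrite ler_norml => /andP[? ?]; apply/andP; split; lra.
  exists (u^~ xi, u^~ xi, lam); split.
  - by split.
  - by split=> //; left.
  - move=> y yP; rewrite -xiP; congr cellv; apply/funext => c.
    by apply/eqP; rewrite eq_le andbC; exact: yP.
  - by move=> c; rewrite subrr ltW.
  - move=> x xi' c; have := cellv_uw x xi c; rewrite xi' xiP => /(_ erefl).
    by rewrite ler_norml => /andP[? ?]; apply/andP; split; lra.
pose lo' i := (d i).1.1; pose hi' i := (d i).1.2; pose lam i := (d i).2.
have {dP} dP i : spec i (lo' i, hi' i, lam i) by rewrite /lo' /hi' /lam -!surjective_pairing.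
have disj (i j : I) y : in_box (lo' i) (hi' i) y -> in_box (lo' j) (hi' j) y -> i = j.
  have [_ _ ci _ _] := dP i; have [_ _ cj _ _] := dP j.
  by move=> /ci ei /cj ej; apply/val_inj; rewrite -ei -ej.
have zero i : ~ in_box (lo' i) (hi' i) (fun=> 0).
  by have [_ _ ci _ _] := dP i; move=> /ci ei; have := Pn0 i; rewrite -ei eqxx.
have cell_I x : cellv (u^~ x) != al0 -> exists i : I, val i = cellv (u^~ x).
  move=> xn0; have Px : P (cellv (u^~ x)) by rewrite /P xn0 andbT; apply/asboolP; exists x.
  by exists (Sub _ Px).
have cover x : (exists i, forall c, lo' i c - w <= u c x <= hi' i c + w) \/
    forall c, `|u c x| <= w.
  have [e0|/cell_I[i ix]] := eqVneq (cellv (u^~ x)) al0.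
    by right=> c; exact: cellv_0w.
  by left; exists i; have [_ _ _ _ /(_ x (esym ix))] := dP i.
have [phi [phi0 [phip phi1] phibox phir phis]] := cluster_partition u0 w0 disj zero cover.
have lamL i : linear_C0r (lam i) by have [[]] := dP i.
have lam_le i h b : C0r h -> (forall x, in_box (lo' i) (hi' i) (u^~ x) -> h x <= b) -> lam i h <= b.
  by have [[_ lamB] _ _ _ _] := dP i; exact: lamB.
have lam_ge i h b : C0r h -> (forall x, in_box (lo' i) (hi' i) (u^~ x) -> b <= h x) -> b <= lam i h.
  move=> h0 hb; rewrite -lerN2 -(linN (lamL i))//; apply: lam_le => [|x xi]; first exact: C0rN.
  by rewrite lerN2 hb.
exists I, phi, lam; split.
- by split.
- by split=> // i h b h0 hb; apply: lam_le.
- split.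
    move=> i j; apply/eqP; rewrite eq_le lam_le ?lam_ge// => x /phibox /(_ j) -> //.
  have /cell_I[i _] : cellv (u^~ x0) != al0.
    by apply/eqP => /(cellv_0w _ c0); lra.
  by exists.
(* On the support of [phi i] both [u c x] and [lam i (u c)] are near a box of width at most [w];
   where mass is missing, [u c x] is near 0. The bound is an average with weights [phi i x] and
   [1 - \sum_i phi i x]. *)
- move=> c x; rewrite (_ : _ - _ = \sum_i (lam i (u c) - u c x) * phi i x
      - (1 - \sum_i phi i x) * u c x); last first.
    rewrite mulrBl mul1r mulr_suml opprB addrA -big_split/=; congr (_ - _).
    by apply: eq_bigr => i _; ring.
  have rw : (2 * #|C|).+1%:R * w + w = (2 * #|C|).+2%:R * w.
    by rewrite -[(2 * #|C|).+2%:R]natr1 mulrDl mul1r.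
  apply: le_trans weps.
  rewrite -[leRHS]mul1r -[X in _ <= X * _](subrKC (\sum_i phi i x) 1).
  rewrite [leRHS]mulrDl mulr_suml (le_trans (ler_normB _ _))//; apply: lerD.
    rewrite (le_trans (ler_norm_sum _ _ _))//; apply: ler_sum => i _.
    rewrite normrM (ger0_norm (phip i x)) mulrC.
    have [->|px] := eqVneq (phi i x) 0; first by rewrite !mul0r.
    rewrite ler_wpM2l//; have /andP[x1 x2] := phir i x c px.
    have [_ _ _ /(_ c) wi _] := dP i.
    rewrite ler_norml lerBlDr lerBrDr; apply/andP; split.
      by apply: lam_ge => // x' /(_ c)/andP[? ?]; lra.
    by apply: lam_le => // x' /(_ c)/andP[? ?]; lra.
  have p1 : 0 <= 1 - \sum_i phi i x by rewrite subr_ge0.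
  rewrite normrM (ger0_norm p1).
  have [e|ne] := eqVneq (\sum_i phi i x) 1; first by rewrite e subrr !mul0r.
  by rewrite ler_wpM2l// (le_trans (phis x c ne))// -rw lerDl ltW.
move=> c h h0 h1; pose Ph x := \sum_i lam i h * phi i x.
have lamh i : `|lam i h| <= 1.
  rewrite ler_norml lam_ge ?lam_le// => x _; have := h1 x; rewrite ler_norml => /andP[//].
have Ph0 : C0r Ph by apply: C0r_sum => i _; exact: C0rZ.
have Ph1 x : `|Ph x| <= 1.
  rewrite (le_trans (ler_norm_sum _ _ _))// (le_trans _ (phi1 x))//.
  by apply: ler_sum => i _; rewrite normrM (ger0_norm (phip i x)) ler_piMl.
have Phh x : `|Ph x - h x| <= 2.
  by rewrite (le_trans (ler_normB _ _))// (_ : 2 = 1 + 1)// lerD.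
pose K x := u c x * (Ph x - h x).
have K0 : C0r K by apply: C0rM => //; exact: C0rB.
rewrite -/(K _).
(* [K] is split along [1 = \sum_(i : I) psi (val i) + rem + (1 - Psi)]: retained cells, discarded
   cells, boundary zones. *)
pose rem x := \sum_(al | ~~ P al) psi al x.
pose Psi x := \sum_al psi al x.
have PsiE x : Psi x = \sum_(i : I) psi (val i) x + rem x.
  rewrite /Psi (bigID P)/=; congr (_ + _).
  rewrite (reindex_omap (val : I -> _) insub)/=; last by move=> al Pal; rewrite insubT.
  by apply: eq_bigl => -[al Pal] /=; rewrite insubT Pal eqxx.
have PsiP x : Psi x = \prod_c' \sum_a q (k c') a (u c' x).
  by rewrite bigA_distr_bigA.
have rem_ge0 x : 0 <= rem x by exact: sumr_ge0.
have psiI_ge0 x : 0 <= \sum_(i : I) psi (val i) x by exact: sumr_ge0.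
have [Psi1 PsiB] : (forall x, 0 <= Psi x <= 1) /\
    forall x, 1 - Psi x <= \sum_c' (1 - \sum_a q (k c') a (u c' x)).
  by split=> x; rewrite PsiP; have [] := sub_prod_le_sum (index_enum C)
    (fun c' => q_sum (k c') (u c' x)).
(* A discarded cell that carries a point is the cell of the origin, where every [u c] is small. *)
have rem_w x : rem x != 0 -> `|u c x| <= w.
  move=> rx; have [al /andP[nP al_x]] : exists al, ~~ P al && (psi al x != 0).
    apply/not_existsP => nal; move/eqP: rx; apply; rewrite /rem big1// => al nP.
    by apply/eqP; apply: contraPT (nal al) => ->; rewrite nP; apply.
  have xal := box_cellv _ _ (psi_box _ _ al_x); apply: cellv_0w.
  have [//|/cell_I[i ix]] := eqVneq (cellv (u^~ x)) al0.
  by move: nP; rewrite -xal -ix (valP i).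
have part0 (i : I) : C0r (fun x => psi (val i) x * K x) by apply: C0rM => //; exact: psi0.
have sum0 : C0r (fun x => \sum_(i : I) psi (val i) x * K x).
  by apply: (@C0r_sum R L _ _ _ (fun (i : I) x => psi (val i) x * K x)) => i _.
pose E1 x := rem x * K x.
have E10 : C0r E1.
  apply: (@C0rMb _ _ _ _ 1) => // [x|x].
    by apply: cvg_big => [|al _]; [exact: add_continuous|exact: psic].
  rewrite ger0_norm//; have /andP[_] := Psi1 x; rewrite PsiE; have := psiI_ge0 x; lra.
pose E2 x := K x - \sum_(i : I) psi (val i) x * K x - E1 x.
have E20 : C0r E2 by do 2?apply: C0rB.
have E2E x : E2 x = (1 - Psi x) * K x.
  by rewrite /E2 /E1 PsiE -mulr_suml; ring.
have vK : v K = \sum_(i : I) v (fun x => psi (val i) x * K x) + v E1 + v E2.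
  rewrite -(lin_sum vl)// -!(linD vl)//; last exact: C0rD.
  by congr v; apply/funext => x; rewrite /E2; ring.
have vsum : `|\sum_(i : I) v (fun x => psi (val i) x * K x)| <= 2 * w * M.
  have sp0 : C0r (fun x => \sum_(i : I) psi (val i) x) by apply: C0r_sum => i _; exact: psi0.
  apply: (@le_trans _ _ (2 * w * v (fun x => \sum_(i : I) psi (val i) x))); last first.
    rewrite ler_wpM2l ?mulr_ge0 ?(ltW w0)// -[leRHS]mulr1 (le_trans (ler_norm _))//.
    apply: vb => // x; rewrite ger0_norm//.
    by have /andP[_] := Psi1 x; rewrite PsiE; have := rem_ge0 x; lra.
  rewrite (lin_sum vl)//; last by move=> i _; exact: psi0.
  rewrite mulr_sumr (le_trans (ler_norm_sum _ _ _))//; apply: ler_sum => i _.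
  have [_ [vlam supp] ci _ _] := dP i.
  case: supp => [vpsi|supp]; first by rewrite vlam// vpsi !mul0r mulr0 normr0.
  have [[x1 x1P]|nx1] := pselect (exists x1, cellv (u^~ x1) = val i); last by case: nx1.
  (* On the support of [psi (val i)] only [phi i] is nonzero and it equals 1, so [K] is [u c] times
     [lam i h - h]; within the cell [u c] differs from its value at [x1] by at most [w]. *)
  apply: (@cell_defect _ h _ (u c x1) (lam i h)) => //; [exact: psi0|exact: vlam|].
  move=> x px; have xi := supp _ px.
  have -> : K x = u c x * (lam i h - h x).
    rewrite /K /Ph (bigD1 i)//= (phibox _ _ xi i) eqxx mulr1 big1 ?addr0// => j ji.
    by rewrite (phibox _ _ xi j) (negbTE ji) mulr0.
  rewrite -mulrBl normrM mulrC; apply: ler_pM => //.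
    by rewrite (le_trans (ler_normB _ _))// (_ : 2 = 1 + 1)// lerD.
  by apply: cellv_uw; rewrite (ci _ xi) x1P.
have vE1 : `|v E1| <= 2 * w * M.
  rewrite mulrC; apply: vb => // [|x]; first by rewrite mulr_ge0// ltW.
  rewrite normrM (ger0_norm (rem_ge0 x)).
  have [->|rx] := eqVneq (rem x) 0; first by rewrite mul0r mulr_ge0// ltW.
  apply: (@le_trans _ _ `|K x|).
    rewrite ler_piMl//; have /andP[_] := Psi1 x; rewrite PsiE; have := psiI_ge0 x; lra.
  by rewrite normrM mulrC ler_pM// rem_w.
have vE2 : `|v E2| <= eps / 2.
  pose H x := \sum_c' (G x * (1 - \sum_a q (k c') a (u c' x))).
  have H0 : C0r H by apply: C0r_sum => c' _; case: (kP c').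
  have : `|v E2| <= v (fun x => 2 * H x).
    apply: lin_abs => // [|x]; first exact: C0rZ.
    have p0 : 0 <= 1 - Psi x by rewrite subr_ge0; case/andP: (Psi1 x).
    rewrite E2E normrM (ger0_norm p0) /H -mulr_sumr.
    have uG : `|u c x| <= G x by rewrite /G (bigD1 c)//= lerDl sumr_ge0.
    have KG : `|K x| <= 2 * G x by rewrite normrM mulrC ler_pM.
    apply: (le_trans (ler_pM p0 (normr_ge0 _) (PsiB x) KG)).
    by rewrite mulrC mulrA.
  move=> /le_trans; apply; rewrite (linZ vl)// (lin_sum vl); last by move=> c' _; case: (kP c').
  have NR : 0 < N%:R :> R by rewrite ltr0n.
  rewrite -(ler_pM2l NR); apply: le_trans NP; rewrite mulrCA -mulrA ler_pM2l// mulr_sumr.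
  apply: (@le_trans _ _ (\sum_(c' : C) v G)); first by apply: ler_sum => c' _; case: (kP c').
  by rewrite sumr_const -(mulr_natl (v G) #|C|).
rewrite vK (le_trans (ler_normD _ _))// (le_trans (lerD (ler_normD _ _) (lexx _)))//.
by move: vsum vE1 vE2 wM; move: `|_| `|_| `|_| => *; lra.
Qed.

End localized_projection.

(** * Real and complex scalars *)

Section scalars.
Variables (R : realType) (k : scalar_kind).
Local Notation K := (scalar_field R k).
Implicit Types (z w : K) (x y : R).

Definition scal_re z : R :=
  (match k return scalar_field R k -> R with
   | RealScalars => id | ComplexScalars => @complex.Re R end) z.

Definition scal_im z : R :=
  (match k return scalar_field R k -> R with
   | RealScalars => fun=> 0 | ComplexScalars => @complex.Im R end) z.

(** Over the reals [y] is discarded, so the imaginary part of [scal x y] is recovered only for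
    [y = 0], as in [scal_im0]. *)
Definition scal x y : K :=
  match k return scalar_field R k with
  | RealScalars => x | ComplexScalars => Complex x y end.

Lemma scalE z : scal (scal_re z) (scal_im z) = z.
Proof. by move: z; rewrite /scal /scal_re /scal_im; case: k => // -[]. Qed.

Lemma scal_reK x y : scal_re (scal x y) = x.
Proof. by rewrite /scal /scal_re; case: k. Qed.

Lemma scal_im0 x : scal_im (scal x 0) = 0.
Proof. by rewrite /scal /scal_im; case: k. Qed.

Lemma scal_ext z w : scal_re z = scal_re w -> scal_im z = scal_im w -> z = w.
Proof. by move=> er ei; rewrite -[z]scalE -[w]scalE er ei. Qed.

Lemma scal_reD z w : scal_re (z + w) = scal_re z + scal_re w.
Proof. by move: z w; rewrite /scal_re; case: k => // -[? ?] []. Qed.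

Lemma scal_imD z w : scal_im (z + w) = scal_im z + scal_im w.
Proof.
by move: z w; rewrite /scal_im; case: k => [? ?|[? ?] [? ?]] //; rewrite addr0.
Qed.

Lemma scal_reM z w : scal_re (z * w) = scal_re z * scal_re w - scal_im z * scal_im w.
Proof.
by move: z w; rewrite /scal_re /scal_im; case: k => [z w|[? ?] [? ?]] //; rewrite mul0r subr0.
Qed.

Lemma scal_imM z w : scal_im (z * w) = scal_re z * scal_im w + scal_im z * scal_re w.
Proof.
move: z w; rewrite /scal_re /scal_im; case: k => [z w|[? ?] [? ?]] //.
by rewrite mulr0 mul0r addr0.
Qed.

Lemma scal_re0 : scal_re 0 = 0. Proof. by rewrite /scal_re; case: k. Qed.

Lemma scal_reN z : scal_re (- z) = - scal_re z.
Proof. by apply/eqP; rewrite -addr_eq0 -scal_reD addNr scal_re0. Qed.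

Lemma scal_imN z : scal_im (- z) = - scal_im z.
Proof. by move: z; rewrite /scal_im; case: k => [z|[? ?]] //; rewrite oppr0. Qed.

Lemma ler_scal x y : (scal x 0 <= scal y 0) = (x <= y).
Proof. by rewrite /scal; case: k => //; exact: lecR. Qed.

Lemma ltr_scal x y : (scal x 0 < scal y 0) = (x < y).
Proof. by rewrite /scal; case: k => //; exact: ltcR. Qed.

Lemma scal0 : scal 0 0 = 0. Proof. by rewrite /scal; case: k. Qed.

Lemma scal1 : scal 1 0 = 1. Proof. by rewrite /scal; case: k. Qed.

Lemma scalD x y : scal (x + y) 0 = scal x 0 + scal y 0.
Proof. by apply: scal_ext; rewrite ?scal_reD ?scal_imD ?scal_reK ?scal_im0 ?addr0. Qed.

Lemma scalM x y : scal (x * y) 0 = scal x 0 * scal y 0.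
Proof.
by apply: scal_ext; rewrite ?scal_reM ?scal_imM !scal_reK !scal_im0 ?mulr0 ?mul0r ?subr0 ?addr0.
Qed.

Lemma scal_norm x : `|scal x 0| = scal `|x| 0.
Proof.
rewrite /scal; case: k => //.
by rewrite normc_def /= [0 ^+ 2]expr0n addr0 sqrtr_sqr.
Qed.

Lemma scal_sum (I : finType) (F : I -> R) : scal (\sum_i F i) 0 = \sum_i scal (F i) 0.
Proof.
elim/big_ind2: _ => //; first exact: scal0.
by move=> x1 x2 y1 y2 <- <-; rewrite -scalD.
Qed.

Lemma scal_re_sum (I : finType) (F : I -> K) : scal_re (\sum_i F i) = \sum_i scal_re (F i).
Proof.
elim/big_ind2: _ => //; first exact: scal_re0.
by move=> x1 x2 y1 y2 <- <-; rewrite -scal_reD.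
Qed.

Lemma scal_im_sum (I : finType) (F : I -> K) : scal_im (\sum_i F i) = \sum_i scal_im (F i).
Proof.
elim/big_ind2: _ => //; first by rewrite -scal0 scal_im0.
by move=> x1 x2 y1 y2 <- <-; rewrite -scal_imD.
Qed.

Lemma normE z : `|z| = scal (scal_re `|z|) 0.
Proof.
by move: z; rewrite /scal /scal_re; case: k => // z; rewrite normc_def.
Qed.

Lemma normvE (V : normedModType K) (v : V) : `|v| = scal (scal_re `|v|) 0.
Proof. by rewrite -[in RHS]normr_id -normE normr_id. Qed.

Lemma scal_gt0P z : 0 < z -> exists2 x, 0 < x & z = scal x 0.
Proof.
move=> z0; have zE : z = scal (scal_re z) 0 by rewrite -(gtr0_norm z0) -normE.
by exists (scal_re z); rewrite // -ltr_scal -zE scal0.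
Qed.

Lemma norm_sqrE z : scal_re `|z| ^+ 2 = scal_re z ^+ 2 + scal_im z ^+ 2.
Proof.
move: z; rewrite /scal_re /scal_im; case: k => z.
  by rewrite /= [0 ^+ 2]expr0n addr0 real_normK ?num_real.
by rewrite normc_def /= sqr_sqrtr// addr_ge0 ?sqr_ge0//; case: z.
Qed.

Lemma norm_re_ge0 z : 0 <= scal_re `|z|.
Proof. by rewrite -ler_scal -normE scal0. Qed.

Lemma norm_le z x : (`|z| <= scal x 0) = (scal_re `|z| <= x).
Proof. by rewrite {1}normE ler_scal. Qed.

Lemma normr_le_of_sqr x y : 0 <= y -> x ^+ 2 <= y ^+ 2 -> `|x| <= y.
Proof. by move=> y0 xy; rewrite -ler_sqr ?nnegrE// real_normK ?num_real. Qed.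

Lemma re_le_norm z : `|scal_re z| <= scal_re `|z|.
Proof.
by apply: normr_le_of_sqr; rewrite ?norm_re_ge0// norm_sqrE lerDl sqr_ge0.
Qed.

Lemma im_le_norm z : `|scal_im z| <= scal_re `|z|.
Proof.
by apply: normr_le_of_sqr; rewrite ?norm_re_ge0// norm_sqrE lerDr sqr_ge0.
Qed.

Lemma norm_le_reim z : scal_re `|z| <= `|scal_re z| + `|scal_im z|.
Proof.
rewrite (le_trans (ler_norm _))//; apply: normr_le_of_sqr; first exact: addr_ge0.
rewrite norm_sqrE -(real_normK (num_real (scal_re z))) -(real_normK (num_real (scal_im z))).
have := normr_ge0 (scal_re z); have := normr_ge0 (scal_im z).
by move: `|_| `|_| => a b a0 b0; nra.
Qed.

(** Cauchy-Schwarz in the plane; the left side is the real part of [z] times the conjugate of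
    [w]. *)
Lemma reim_le_norm z w :
  scal_re z * scal_re w + scal_im z * scal_im w <= scal_re `|z| * scal_re `|w|.
Proof.
rewrite (le_trans (ler_norm _))//; apply: normr_le_of_sqr.
  by rewrite mulr_ge0 ?norm_re_ge0.
rewrite [leRHS]exprMn !norm_sqrE.
have := sqr_ge0 (scal_re z * scal_im w - scal_im z * scal_re w).
by move: (scal_re z) (scal_im z) (scal_re w) (scal_im w) => a b c d; nra.
Qed.

End scalars.

(** * Passage between real and scalar-valued functions *)

Section scalar_functions.
Variables (R : realType) (k : scalar_kind) (L : topologicalType).
Local Notation K := (scalar_field R k).
Implicit Types (f g : L -> R) (h : C0 K L).

Lemma C0_of_dominated f h : (forall x y, `|f x - f y| <= scal_re `|h x - h y|) ->
  (forall x, `|f x| <= scal_re `|h x|) -> C0r f.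
Proof.
move=> fc fh; split=> [x|].
  apply/cvgrPdist_lt => e e0; have := @C0_continuous _ _ h x.
  move=> /cvgrPdist_lt/(_ (scal k e 0)).
  rewrite -(scal0 R k) ltr_scal => /(_ e0); apply: filterS => y.
  by rewrite [in X in X -> _]normE ltr_scal; exact: le_lt_trans.
apply/cvgr0Pnorm_lt => e e0; have := @C0_vanishes _ _ h (scal k e 0).
rewrite -(scal0 R k) ltr_scal => /(_ e0)[C cC hC]; exists C => // x /hC.
by rewrite [in X in X -> _]normE ltr_scal; exact: le_lt_trans.
Qed.

Lemma C0r_re h : C0r (fun x => scal_re (h x)).
Proof.
apply: (@C0_of_dominated _ h) => [x y|x]; last exact: re_le_norm.
by rewrite -scal_reN -scal_reD re_le_norm.
Qed.

Lemma C0r_im h : C0r (fun x => scal_im (h x)).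
Proof.
apply: (@C0_of_dominated _ h) => [x y|x]; last exact: im_le_norm.
by rewrite -scal_imN -scal_imD im_le_norm.
Qed.

Lemma C0_scal f : C0r f -> (fun x => scal k (f x) 0) \in @C0_pred K L.
Proof.
move=> [cf f0]; rewrite inE; split=> [x|e /scal_gt0P[e' e'0 ->]].
  apply/cvgrPdist_lt => e /scal_gt0P[e' e'0 ->].
  have := cf x; move=> /cvgrPdist_lt/(_ _ e'0); apply: filterS => y fxy.
  have -> : scal k (f x) 0 - scal k (f y) 0 = scal k (f x - f y) 0.
    by apply/eqP; rewrite subr_eq -scalD subrK.
  by rewrite scal_norm ltr_scal.
move: f0 => /cvgr0Pnorm_lt/(_ _ e'0)[C cC fC]; exists C => // x /fC.
by rewrite scal_norm ltr_scal.
Qed.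

(* Junk value [0] outside [C0r]. *)
Definition C0_lift f : C0 K L :=
  match pselect (C0r f) with left f0 => MkC0 (C0_scal f0) | right _ => 0 end.

Lemma C0_liftE f x : C0r f -> C0_lift f x = scal k (f x) 0.
Proof. by rewrite /C0_lift; case: pselect. Qed.

Lemma C0_ext h h' : (forall x, h x = h' x) -> h = h'.
Proof. by move=> e; apply/val_inj/funext. Qed.

Lemma C0_addE h h' x : (h + h') x = h x + h' x. Proof. by []. Qed.
Lemma C0_scaleE (a : K) h x : (a *: h) x = a * h x. Proof. by []. Qed.
Lemma C0_oppE h x : (- h) x = - h x. Proof. by []. Qed.

Lemma C0_sumE (I : finType) (F : I -> C0 K L) x : (\sum_i F i) x = \sum_i F i x.
Proof. by elim/big_ind2: _ => // h1 h2 y1 y2 <- <-. Qed.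

Lemma C0_lift_lin a f g : C0r f -> C0r g ->
  C0_lift (fun x => a * f x + g x) = scal k a 0 *: C0_lift f + C0_lift g.
Proof.
move=> f0 g0; apply: C0_ext => x.
by rewrite C0_addE C0_scaleE !C0_liftE ?scalD ?scalM//; apply: C0rD => //; exact: C0rZ.
Qed.

(** [scal k 0 1] is the imaginary unit over the complex numbers and 0 over the reals, where the
    second term disappears. *)
Lemma C0_reim h : h = C0_lift (fun x => scal_re (h x)) +
  scal k 0 1 *: C0_lift (fun x => scal_im (h x)).
Proof.
apply: C0_ext => x; rewrite C0_addE C0_scaleE !C0_liftE; [|exact: C0r_im|exact: C0r_re].
move: (h x); rewrite /scal /scal_re /scal_im; case: k => [z|[a b]].
  by rewrite /= mulr0 addr0.
by apply/eqP; rewrite eq_complex /= !(mul0r, mulr0, mul1r, addr0, add0r, subr0) !eqxx.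
Qed.

End scalar_functions.

(** * The projection *)

Section matrix_norm.
Variables (K : numFieldType) (m n : nat).
Implicit Types w : 'M[K]_(m, n).

Lemma le_mx_norm w i j : `|w i j| <= `|w|.
Proof.
rewrite [leRHS]/Num.norm/= mx_normE -[leLHS]nngE num_le.
exact: (le_bigmax _ (fun ij => `|w ij.1 ij.2|%:nng) (i, j)).
Qed.

Lemma mx_norm_le w b : 0 <= b -> (forall i j, `|w i j| <= b) -> `|w| <= b.
Proof.
move=> b0 wb; rewrite /Num.norm/=; have [->//|/mx_norm_neq0[[i j] ->]] := eqVneq (mx_norm w) 0.
exact: wb.
Qed.

End matrix_norm.

(** Complete regularity separates a point from the complement of the interior of a compact
    neighbourhood; one minus the separating function vanishes off that neighbourhood. *)
Lemma exists_C0r_peak (R : realType) (L : topologicalType) :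
  [set: L] !=set0 -> locally_compact [set: L] -> hausdorff_space L ->
  exists (f : L -> R) x, C0r f /\ f x = 1.
Proof.
move=> [x _] lc hL; have [U xU [cU _]] := lc x I.
have {}xU : nbhs x U by move: xU; rewrite /within/=; apply: filterS => y; exact.
have := @locally_compact_completely_regular L R lc hL x (~` U°).
move=> /(_ (open_closedC (open_interior U)))/(_ (fun n => n xU)).
move=> /(uniform_separatorP (R := R))[f [cf f01 fx fB]].
have fx0 : f x = 0 by apply: fx; exists x.
exists (fun y => 1 - f y), x; split; last by rewrite fx0 subr0.
split=> [y|]; first by apply: cvgB (cf y); exact: cvg_cst.
apply/cvgr0Pnorm_lt => e e0; exists U => // y nUy.
rewrite /= (_ : f y = 1) ?subrr ?normr0//; apply: fB; exists y => //.
by move=> /interior_subset.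
Qed.

(** * Real and imaginary parts of a functional *)

Section functional_parts.
Variables (R : realType) (k : scalar_kind) (L : topologicalType).
Local Notation K := (scalar_field R k).
Variable mu : dual_space (C0 K L).
Hypothesis mu1 : `|mu| <= 1.

Definition functional_part (b : bool) (f : L -> R) : R :=
  if b then scal_re (mu (C0_lift k f)) else scal_im (mu (C0_lift k f)).

Lemma functional_part_linear b : linear_C0r (functional_part b).
Proof.
move=> a f g f0 g0; rewrite /functional_part C0_lift_lin// linearP.
case: b; rewrite ?scal_reD ?scal_imD; congr (_ + _).
  by rewrite [LHS]scal_reM scal_reK scal_im0 mul0r subr0.
by rewrite [LHS]scal_imM scal_reK scal_im0 mul0r addr0.
Qed.

Lemma functional_part_bounded b : bounded_C0r 1 (functional_part b).
Proof.
move=> f c f0 c0 fc; rewrite mul1r; apply: (@le_trans _ _ (scal_re `|mu (C0_lift k f)|)).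
  by rewrite /functional_part; case: b; [exact: re_le_norm|exact: im_le_norm].
rewrite -norm_le; apply: le_trans (le_op_norm mu _) _.
apply: (@le_trans _ _ `|C0_lift k f|); first by rewrite ler_piMl.
apply: C0_norm_le => [|x]; first by rewrite -(scal0 R k) ler_scal.
by rewrite C0_liftE// scal_norm ler_scal.
Qed.

Lemma functional_parts_norm (h : C0 K L) : scal_re `|mu h| <=
  `|functional_part true (fun x => scal_re (h x))| +
  `|functional_part false (fun x => scal_re (h x))| +
  `|functional_part true (fun x => scal_im (h x))| +
  `|functional_part false (fun x => scal_im (h x))|.
Proof.
rewrite {1}(C0_reim h) linearD linearZ /=.
set a := mu (C0_lift k _); set b := mu (C0_lift k _).
(* The factor has modulus 1 or 0, according to the scalars. *)
have le : `|(scal k 0 1 *: (b : K^o) : K)| <= `|b|.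
  rewrite normrZ ler_piMl// -(scal1 R k) norm_le -ler_sqr ?nnegrE ?norm_re_ge0//.
  rewrite norm_sqrE scal_reK expr0n add0r -real_normK ?num_real//.
  by rewrite ler_sqr ?nnegrE// /scal_im /scal; case: k; rewrite ?normr0 ?normr1.
have : scal_re `|a + scal k 0 1 *: (b : K^o)| <= scal_re `|a| + scal_re `|b|.
  rewrite -norm_le scalD -!normE.
  by apply: le_trans (ler_normD _ _) _; rewrite lerD2l.
move=> /le_trans; apply; rewrite -addrA.
by apply: lerD; exact: norm_le_reim.
Qed.

End functional_parts.

(** * From the real data to a projection over the scalars *)

Section finite_rank_projection.
Variables (R : realType) (k : scalar_kind) (L : topologicalType).
Local Notation K := (scalar_field R k).
Variables (I : finType) (phi : I -> L -> R) (lam : I -> (L -> R) -> R).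
Hypotheses (phi0 : forall i, C0r (phi i)) (phip : forall i x, 0 <= phi i x)
  (phi1 : forall x, \sum_i phi i x <= 1).
Hypotheses (lamL : forall i, linear_C0r (lam i))
  (lamB : forall i h b, C0r h -> (forall x, h x <= b) -> lam i h <= b)
  (biorth : forall i j, lam i (phi j) = (j == i)%:R).
Implicit Types h g : C0 K L.

Definition lamK i h : K :=
  scal k (lam i (fun x => scal_re (h x))) (lam i (fun x => scal_im (h x))).

Lemma lamK_re i h : scal_re (lamK i h) = lam i (fun x => scal_re (h x)).
Proof. exact: scal_reK. Qed.

Lemma lamK_im i h : scal_im (lamK i h) = lam i (fun x => scal_im (h x)).
Proof.
rewrite /lamK /scal_im /scal; move: h; case: k => //= h.
by rewrite (lin0 (lamL i)).
Qed.

Lemma lamK_linear i (a : K) h g :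
  lamK i (a *: h + g) = a * lamK i h + lamK i g.
Proof.
have := (C0r_re h, C0r_im h, C0r_re g, C0r_im g) => -[[[hr hi] gr] gi].
apply: scal_ext.
  rewrite scal_reD scal_reM !lamK_re lamK_im.
  rewrite -!(linZ (lamL i))// -(linB (lamL i)) -?(linD (lamL i));
    do ?[exact: C0rZ|by []|by apply: C0rB; exact: C0rZ].
  by congr (lam i); apply/funext => x; rewrite C0_addE C0_scaleE scal_reD scal_reM.
rewrite scal_imD scal_imM !lamK_im lamK_re.
rewrite -!(linZ (lamL i))// -!(linD (lamL i));
  do ?[exact: C0rZ|by []|by apply: C0rD; exact: C0rZ].
by congr (lam i); apply/funext => x; rewrite C0_addE C0_scaleE scal_imD scal_imM.
Qed.

(** With [z = lamK i h], [|z|^2] is [lam i] of the real part of [conj z * h], which is pointwise at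
    most [|z|] times the norm of [h]; then divide by [|z|]. Positivity of the real functional thus
    passes to scalars without loss of constant. *)
Lemma lamK_norm i h : `|lamK i h| <= `|h|.
Proof.
rewrite [`|h|]normvE norm_le; set z := lamK i h.
have hr := C0r_re h; have hi := C0r_im h.
have : scal_re `|z| ^+ 2 <= scal_re `|z| * scal_re `|h|.
  rewrite norm_sqrE !expr2 {2}lamK_re {2}lamK_im -!(linZ (lamL i))//.
  rewrite -(linD (lamL i)); do ?exact: C0rZ.
  apply: lamB => [|x]; first by apply: C0rD; exact: C0rZ.
  apply: le_trans (reim_le_norm z (h x)) _; rewrite ler_wpM2l ?norm_re_ge0//.
  by rewrite -norm_le -normvE; exact: le_C0_norm.
rewrite expr2; have [->|z0] := eqVneq (scal_re `|z|) 0.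
  by move=> _; rewrite -(ler_scal k) -normvE scal0.
by rewrite ler_pM2l// lt0r z0 norm_re_ge0.
Qed.

Lemma lamK_lift i j : lamK i (C0_lift k (phi j)) = (j == i)%:R.
Proof.
rewrite /lamK [X in lam i X](_ : _ = phi j); last first.
  by apply/funext => x; rewrite C0_liftE// scal_reK.
rewrite [X in scal k _ (lam i X)](_ : _ = fun=> 0); last first.
  by apply/funext => x; rewrite C0_liftE// scal_im0.
by rewrite biorth (lin0 (lamL i)); case: eqP; rewrite ?scal1 ?scal0.
Qed.

Definition combination (a : I -> K) : C0 K L := \sum_i a i *: C0_lift k (phi i).

Lemma combinationE a x : combination a x = \sum_i a i * scal k (phi i x) 0.
Proof.
by rewrite C0_sumE; apply: eq_bigr => i _; rewrite C0_scaleE C0_liftE.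
Qed.

Lemma combination_norm a (b : K) : 0 <= b -> (forall i, `|a i| <= b) -> `|combination a| <= b.
Proof.
move=> b0 ab; apply: C0_norm_le => // x; rewrite combinationE.
apply: le_trans (ler_norm_sum _ _ _) _.
apply: (@le_trans _ _ (\sum_i b * scal k (phi i x) 0)).
  apply: ler_sum => i _; rewrite normrM scal_norm (ger0_norm (phip i x)).
  by rewrite ler_wpM2r// -(scal0 R k) ler_scal.
by rewrite -mulr_sumr -scal_sum ler_piMr// -(scal1 R k) ler_scal.
Qed.

Lemma lamK0 i : lamK i 0 = 0.
Proof. by have := lamK_linear i (-1) 0 0; rewrite scaler0 addr0 mulN1r addNr. Qed.

Lemma lamKZ i a h : lamK i (a *: h) = a * lamK i h.
Proof. by have := lamK_linear i a h 0; rewrite lamK0 !addr0. Qed.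

Lemma lamK_combination i a : lamK i (combination a) = a i.
Proof.
have sumE (F : I -> C0 K L) : lamK i (\sum_j F j) = \sum_j lamK i (F j).
  elim/big_ind2: _ => [|h1 h2 y1 y2 <- <-|//]; first exact: lamK0.
  by have := lamK_linear i 1 h2 y2; rewrite scale1r mul1r.
rewrite sumE (bigD1 i)//= big1 ?addr0 => [|j ji]; rewrite lamKZ lamK_lift.
  by rewrite eqxx mulr1.
by rewrite (negbTE ji) mulr0.
Qed.

Definition projection_fun h := combination (lamK^~ h).

Lemma projection_norm h : `|projection_fun h| <= `|h|.
Proof. by apply: combination_norm => // i; exact: lamK_norm. Qed.

Lemma projection_linear : linear projection_fun.
Proof.
move=> a h g; rewrite /projection_fun /combination scaler_sumr -big_split/=.
by apply: eq_bigr => i _; rewrite lamK_linear scalerDl scalerA.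
Qed.

Lemma projection_clin : projection_fun \in @clin_pred K (C0 K L) (C0 K L).
Proof.
rewrite inE; split; first exact: projection_linear.
pose lP := GRing.isLinear.Build K _ _ _ projection_fun projection_linear.
pose linP : {linear C0 K L -> C0 K L} := HB.pack projection_fun lP.
apply/(linear_bounded_continuous linP)/linear_boundedP.
near=> r => h; apply: le_trans (projection_norm h) _.
rewrite ler_peMl//; near: r; apply: nbhs_pinfty_ge; exact: real1.
Unshelve. all: by end_near. Qed.

Definition projection : clin (C0 K L) (C0 K L) := MkClin projection_clin.

Lemma projection_idem : is_projection projection.
Proof.
move=> h; rewrite /= {1}/projection_fun; congr combination; apply/funext => i.
exact: lamK_combination.
Qed.

(** The lower bound comes from the nonzero fixed vector [C0_lift k (phi i0)]. *)
Lemma projection_norm1 (i0 : I) : `|projection| = 1.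
Proof.
apply/eqP; rewrite eq_le; apply/andP; split.
  by apply: op_norm_le => // h; apply: le_trans; exact: projection_norm.
have Pphi : projection (C0_lift k (phi i0)) = C0_lift k (phi i0).
  rewrite /= /projection_fun /combination (bigD1 i0)//= big1 ?addr0 => [|j ji].
    by rewrite lamK_lift eqxx scale1r.
  by rewrite lamK_lift eq_sym (negbTE ji) scale0r.
have phi_n0 : C0_lift k (phi i0) != 0.
  apply/eqP => e; have := lamK_lift i0 i0.
  by rewrite e lamK0 eqxx => /eqP; rewrite eq_sym oner_eq0.
have := le_op_norm projection (C0_lift k (phi i0)).
by rewrite Pphi -ler_pdivrMr ?normr_gt0// divff ?normr_eq0.
Qed.

(** [J] takes coordinates to combinations of the bumps: it is contractive as the bumps add up to at
    most 1, and its coordinates are recovered by the contractive [lamK]. *)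
Lemma projection_range : isometric_to_linfty (range projection) #|I|.
Proof.
pose J (w : 'rV[K]_#|I|) := combination (fun i => w 0 (enum_rank i)).
have Jl : linear J.
  move=> a w w'; rewrite /J /combination scaler_sumr -big_split/=.
  by apply: eq_bigr => i _; rewrite !mxE scalerDl scalerA.
pose Jm := GRing.isLinear.Build K _ _ _ J Jl.
pose JL : {linear 'rV[K]_#|I| -> C0 K L} := HB.pack J Jm.
exists JL; split=> [w|].
  apply/eqP; rewrite eq_le; apply/andP; split.
    by apply: combination_norm => // i; exact: le_mx_norm.
  apply: mx_norm_le => // i j; rewrite ord1.
  have := lamK_norm (enum_val j) (J w).
  by rewrite lamK_combination enum_valK.
apply/seteqP; split=> [_ [w _ <-]|_ [h _ <-]].
  exists (J w) => //=; rewrite /projection_fun; congr combination.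
  by apply/funext => i; rewrite lamK_combination.
exists (\row_j lamK (enum_val j) h) => //=; rewrite /J; congr combination.
by apply/funext => i; rewrite mxE enum_rankK.
Qed.

Lemma projection_re h x :
  scal_re (projection h x) = \sum_i lam i (fun y => scal_re (h y)) * phi i x.
Proof.
rewrite [projection h x]combinationE scal_re_sum; apply: eq_bigr => i _.
by rewrite scal_reM scal_reK scal_im0 mulr0 subr0 lamK_re.
Qed.

Lemma projection_im h x :
  scal_im (projection h x) = \sum_i lam i (fun y => scal_im (h y)) * phi i x.
Proof.
rewrite [projection h x]combinationE scal_im_sum; apply: eq_bigr => i _.
by rewrite scal_imM scal_reK scal_im0 mulr0 add0r lamK_im.
Qed.

End finite_rank_projection.

Theorem theorem3p4 (R : realType) (k : scalar_kind) (L : topologicalType)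
    (L_nonempty : [set: L] !=set0)
    (L_locally_compact : locally_compact [set: L])
    (L_hausdorff : hausdorff_space L)
    (l n : nat)
    (f : 'I_l -> C0 (scalar_field R k) L) (f_le1 : forall j, `|f j| <= 1)
    (mu : 'I_n -> dual_space (C0 (scalar_field R k) L))
    (mu_le1 : forall j, `|mu j| <= 1)
    (eps : scalar_field R k) (eps_gt0 : 0 < eps) :
  exists P : clin (C0 (scalar_field R k) L) (C0 (scalar_field R k) L),
    [/\ is_projection P, `|P| = 1,
        forall j, `|adjoint P (mu j) - mu j| < eps,
        forall j, `|P (f j) - f j| < eps &
        exists p : nat, isometric_to_linfty (range P) p].
Proof.
have [e e0 ->] := scal_gt0P eps_gt0.
(* Four real parts of [mu j], at [3 * d] each, give [12 * d] in the first estimate; two parts of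
   [f j] give [2 * d] in the second. *)
pose d := e / 16; have d0 : 0 < d by rewrite divr_gt0.
pose m (jb : 'I_n * bool) := functional_part (mu jb.1) jb.2.
have ml jb : linear_C0r (m jb) by exact: functional_part_linear.
have mb jb : bounded_C0r 1 (m jb) by apply: functional_part_bounded.
have [v [vl vp [M M0 vb] vm]] := common_total_variation ler01 ml mb.
have /choice[g gP] : forall jb, exists g, C0r g /\ forall h, C0r h ->
    (forall x, `|h x| <= 1) -> `|m jb h - v (fun x => g x * h x)| <= d.
  move=> jb; have [g g0 gm] := approximate_density vl vp M0 vb (ml jb) (vm jb) d0.
  by exists g.
have [f0 [x0 [f00 f0x]]] := exists_C0r_peak R L_nonempty L_locally_compact L_hausdorff.
pose part (b : bool) (h : C0 (scalar_field R k) L) x := if b then scal_re (h x) else scal_im (h x).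
(* The peak [f0] ensures a cell away from the origin, [inl] lists the parts of the [f j], and [inr]
   the approximate densities. *)
pose u (c : option ('I_l * bool + 'I_n * bool)) : L -> R :=
  match c with
  | None => f0
  | Some (inl jb) => part jb.2 (f jb.1)
  | Some (inr jb) => g jb
  end.
have u0 c : C0r (u c).
  case: c => [[[j []]|jb]|] //=; [exact: C0r_re|exact: C0r_im|by case: (gP jb)].
have ux0 : 1 <= `|u None x0| by rewrite /= f0x normr1.
have [I [phi [lam [[phi0 phip phi1] [lamL lamB] [biorth [i0]] uP vP]]]] :=
  localized_projection vl vp M0 vb u0 d0 ux0.
pose P := projection k phi0 phip phi1 lamL lamB.
have mP jb h : C0r h -> (forall x, `|h x| <= 1) ->
    `|m jb (fun x => \sum_i lam i h * phi i x - h x)| <= 3 * d.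
  move=> h0 h1; set s := fun x => _.
  have s0 : C0r s by apply: C0rB => //; apply: C0r_sum => i _; exact: C0rZ.
  have lamh i : `|lam i h| <= 1.
    rewrite ler_norml lamB ?andbT//; last first.
      by move=> x; rewrite (le_trans (ler_norm _)).
    rewrite -[leRHS]opprK lerN2 -(linN (lamL i))//; apply: (lamB i) => [|x]; first exact: C0rN.
    by rewrite (le_trans (ler_norm _))// normrN.
  (* [s] is bounded by 2, so the density estimate is applied to its half; this costs [2 * d], and
     [vP] for the density adds [d]. *)
  have s2 x : `|2^-1 * s x| <= 1.
    rewrite normrM normfV normr_nat ler_pdivrMl// mulr1 (le_trans (ler_normB _ _))//.
    rewrite (_ : 2 = 1 + 1)//; apply: lerD => //.
    rewrite (le_trans (ler_norm_sum _ _ _))// (le_trans _ (phi1 x))//.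
    by apply: ler_sum => i _; rewrite normrM (ger0_norm (phip i x)) ler_piMl.
  have [g0 /(_ _ (C0rZ 2^-1 s0) s2)] := gP jb.
  rewrite (linZ (ml jb))// (_ : (fun x => g jb x * _) = fun x => 2^-1 * (g jb x * s x)); last first.
    by apply/funext => x; rewrite mulrCA.
  rewrite (linZ vl); last exact: C0rM.
  have := vP (Some (inr jb)) h h0 h1; rewrite /= -/s.
  by rewrite !ler_norml => /andP[? ?] /andP[? ?]; apply/andP; split; lra.
have partPE b h : part b (P h - h) =
    fun x => \sum_i lam i (part b h) * phi i x - part b h x.
  apply/funext => x; rewrite /part.
  by case: b; rewrite C0_addE C0_oppE ?scal_reD ?scal_imD ?scal_reN ?scal_imN
    ?projection_re ?projection_im.
exists P; split.
- exact: projection_idem.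
- exact: projection_norm1.
- move=> j; apply: (@le_lt_trans _ _ (scal k (12 * d) 0)); last by rewrite ltr_scal /d; lra.
  apply: op_norm_le => [|h h1]; first by rewrite -(scal0 R k) ler_scal mulr_ge0// ltW.
  rewrite (_ : (adjoint P (mu j) - mu j) h = mu j (P h - h)); last by rewrite linearB.
  rewrite norm_le; apply: le_trans (functional_parts_norm _ _) _.
  have h1' x : scal_re `|h x| <= 1.
    by rewrite -norm_le scal1 (le_trans _ h1)// le_C0_norm.
  have b1 b : forall x, `|part b h x| <= 1.
    by move=> x; rewrite (le_trans _ (h1' x))//; case: b; [exact: re_le_norm|exact: im_le_norm].
  have part0 b : C0r (part b h) by case: b; [exact: C0r_re|exact: C0r_im].
  have mpart b b' : `|m (j, b') (part b (P h - h))| <= 3 * d by rewrite partPE; exact: mP.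
  have := mpart true true; have := mpart true false.
  have := mpart false true; have := mpart false false.
  by rewrite /m /part /=; lra.
- move=> j; apply: (@le_lt_trans _ _ (scal k (2 * d) 0)); last by rewrite ltr_scal /d; lra.
  apply: C0_norm_le => [|x]; first by rewrite -(scal0 R k) ler_scal mulr_ge0// ltW.
  rewrite norm_le; apply: le_trans (norm_le_reim _) _.
  have partP b : `|part b (P (f j) - f j) x| <= d.
    by rewrite partPE; exact: (uP (Some (inl (j, b))) x).
  by have := partP true; have := partP false; rewrite /part; lra.
- by exists #|I|; exact: projection_range.
Qed.
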